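(* $C(13,7,5) \ge 77$, $C(14,8,6) \ge 135$, $C(15,9,7) \ge 225$ and $C(16,10,8) \ge 360$.
   Context: Let $v \ge k \ge t \ge 1$ and let $X$ be a set of $v$ points. A $t$-$(v,k,1)$ covering is a pair $(X,\mathcal{B})$ where $\mathcal{B}$ is a set of $k$-subsets of $X$ (called blocks) such that every $t$-subset of $X$ is contained in at least one block of $\mathcal{B}$. The covering number $C(v,k,t)$ is the minimum number of blocks in a $t$-$(v,k,1)$ covering. *)

(* Defs.v *)
From mathcomp Require Import all_boot.

Set Implicit Arguments.
Unset Strict Implicit.
Unset Printing Implicit Defensive.

Definition covering (X : finType) (k t : nat) (B : {set {set X}}) : bool :=
  [forall b in B, #|b| == k] &&
  [forall S : {set X}, (#|S| == t) ==> [exists b in B, S \subset b]].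

(* The search starts from the family of all k-subsets, which is a covering as
   soon as t <= k <= v (covering_all); outside that range the value of
   covering_number is meaningless. *)
Definition covering_number (v k t : nat) : nat :=
  #|[arg min_(B < [set b : {set 'I_v} | #|b| == k] | covering k t B) #|B|]|.

Lemma extend_subset (X : finType) (k : nat) (S : {set X}) :
  #|S| <= k <= #|X| -> exists2 b : {set X}, S \subset b & #|b| = k.
Proof.
elim: k => [|k IHk] /andP[leSk lekX].
  by exists S => //; apply/eqP; rewrite -leqn0.
move: leSk; rewrite leq_eqVlt => /orP[/eqP eqS|]; first by exists S.
rewrite ltnS => leSk; have [|b sSb cb] := IHk; first by rewrite leSk ltnW.
have [x xb] : exists x, x \in ~: b.
  by apply/set0Pn; rewrite -card_gt0 cardsCs setCK cb subn_gt0.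
exists (x |: b); first exact: subset_trans sSb (subsetUr _ _).
by rewrite cardsU1 cb -in_setC xb.
Qed.

Lemma covering_all (X : finType) (k t : nat) : t <= k <= #|X| ->
  covering k t [set b : {set X} | #|b| == k].
Proof.
move=> /andP[letk lekX]; apply/andP; split.
  by apply/forall_inP => b; rewrite inE.
apply/forall_inP => S /eqP cS; have [|b sSb cb] := @extend_subset X k S.
  by rewrite cS letk.
by apply/exists_inP; exists b; rewrite ?inE ?cb.
Qed.

Lemma covering_number_attained (v k t : nat) : t <= k <= v ->
  exists2 B : {set {set 'I_v}}, covering k t B & #|B| = covering_number v k t.
Proof.
move=> le_tkv; rewrite /covering_number; case: arg_minnP => [|B covB _].
  by apply: covering_all; rewrite card_ord.
by exists B.
Qed.

Lemma covering_number_min (X : finType) (k t : nat) (B : {set {set X}}) :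
  t <= k <= #|X| -> covering k t B -> covering_number #|X| k t <= #|B|.
Proof.
move=> le_tkv /andP[/forall_inP cB /forall_inP covB].
rewrite /covering_number; case: arg_minnP => [|A _ minA].
  by apply: covering_all; rewrite card_ord.
rewrite -(card_imset B (imset_inj (@enum_rank_inj X))); apply: minA.
apply/andP; split.
  apply/forall_inP => _ /imsetP[b Bb ->].
  by rewrite card_imset ?cB //; apply: enum_rank_inj.
apply/forall_inP => S cS.
have /covB/exists_inP[b Bb sSb] : #|[set enum_val i | i in S]| == t.
  by rewrite card_imset //; apply: enum_val_inj.
apply/exists_inP; exists (enum_rank @: b); first exact: imset_f.
apply/subsetP => i Si; rewrite -(enum_valK i) imset_f //.
by apply: (subsetP sSb); apply: imset_f.
Qed.

(* Main.v *)
Require Import Defs.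
From mathcomp Require Import all_boot.
From mathcomp Require Import zify.

Set Implicit Arguments.
Unset Strict Implicit.
Unset Printing Implicit Defensive.

(* By the Schonheim inequality k C(v,k,t) >= v C(v-1,k-1,t-1) it suffices that
   C(12,6,4) >= 41.  Write lam for the number of blocks containing given points
   and suppose that 40 blocks suffice.  Since C(10,4,2) >= 9, every point then
   has lam = 20, every point x has a unique partner x' with lam(x,x') = 10, and
   lam(x,y) = 9 for all other y.  So for y <> x, x' the blocks through x and y
   form a (10,4,2) covering with 9 blocks.  In it four points (L) have degree 3
   and six (D) have degree 4, and either some block contains L and the repeated
   pairs form a K4 plus a triple edge on D (type A), or every block meets L in
   0 or 2 points and each point of D lies on a pair covered at least 3 times
   (type B).
   In type A the K4 together with x and y is a "hexad", a 6-set all of whose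
   4-subsets are covered twice.  Counting, modulo 3, the triples through x with
   lam = 4 shows that x lies in exactly two hexads.  Hence there are four
   hexads, any two meeting in a pair {x, x'}, and the triple edges of the pairs
   xy and xr, with y and r in the two different hexads through x, contradict
   each other. *)

(** * Counting the blocks through given points *)

Section Counting.
Variable X : finType.
Implicit Types (F : {set {set X}}) (A Z : {set X}) (s : seq X).

(** This is lam. The points form a list, so that one more point is a cons without side conditions;
    repetitions do no harm. *)
Definition cnt F s : nat := #|[set b in F | all (mem b) s]|.

Lemma cnt_perm F s t : perm_eq s t -> cnt F s = cnt F t.
Proof. by move=> st; apply: eq_card => b; rewrite !inE (perm_all _ st). Qed.

Lemma cnt_sum F Z s :
  \sum_(z in Z) cnt F (z :: s) = \sum_(b in F | all (mem b) s) #|b :&: Z|.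
Proof.
under eq_bigr do rewrite /cnt -sum1_card.
under [RHS]eq_bigr do rewrite -sum1_card.
rewrite (exchange_big_dep [pred b in F | all (mem b) s]) /=.
  apply: eq_bigr => b /andP[Fb sb]; apply: eq_bigl => z.
  by rewrite !inE /= Fb sb andbT andbC.
by move=> z b _; rewrite inE /= => /and3P[-> _ ->].
Qed.

Lemma cnt_sum_const F Z s k :
  (forall b, b \in F -> all (mem b) s -> #|b :&: Z| = k) ->
  \sum_(z in Z) cnt F (z :: s) = k * cnt F s.
Proof.
move=> hk; rewrite cnt_sum (eq_bigr (fun=> k)); last by move=> b /andP[]; apply: hk.
rewrite big_const iter_addn_0; congr (_ * _).
by apply: eq_card => b; rewrite !inE.
Qed.

Lemma cnt_gt0 F s : reflect (exists2 b, b \in F & all (mem b) s) (0 < cnt F s).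
Proof.
apply: (iffP card_gt0P) => [[b]|[b Fb sb]]; last by exists b; rewrite inE Fb.
by rewrite inE => /andP[]; exists b.
Qed.

Lemma cnt_sub F s t : {subset t <= s} -> cnt F s <= cnt F t.
Proof.
move=> ts; apply: subset_leq_card; apply/subsetP => b.
rewrite !inE => /andP[-> /allP sb]; apply/allP => x /ts; exact: sb.
Qed.

Lemma cnt_uniq F s b c : cnt F s = 1 -> b \in F -> c \in F ->
  all (mem b) s -> all (mem c) s -> b = c.
Proof.
move=> /eqP/cards1P[d Ed] Fb Fc sb sc.
have : b \in [set d] by rewrite -Ed inE Fb.
have : c \in [set d] by rewrite -Ed inE Fc.
by rewrite !inE => /eqP-> /eqP->.
Qed.

Lemma cnt_eq_mem F s x b : cnt F s <= cnt F (x :: s) -> b \in F ->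
  all (mem b) s -> x \in b.
Proof.
move=> le Fb sb.
have sub : [set b in F | all (mem b) (x :: s)] \subset [set b in F | all (mem b) s].
  by apply/subsetP => c; rewrite !inE /= => /and3P[-> _ ->].
have /eqP E : [set b in F | all (mem b) (x :: s)] == [set b in F | all (mem b) s].
  by rewrite eqEcard sub.
have : b \in [set b in F | all (mem b) s] by rewrite inE Fb.
by rewrite -E inE /= => /and3P[].
Qed.

End Counting.

Lemma sum_ge_subset (T : finType) (A C : {set T}) (f : T -> nat) c :
  C \subset A -> (forall i, i \in A -> c <= f i) ->
  \sum_(i in C) f i + c * (#|A| - #|C|) <= \sum_(i in A) f i.
Proof.
move=> CA hc; rewrite [leqRHS](big_setID C) /= (setIidPr CA) leq_add2l.
have -> : #|A| - #|C| = #|A :\: C| by rewrite cardsD (setIidPr CA).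
rewrite mulnC -sum_nat_const.
by apply: leq_sum => i; rewrite inE => /andP[_ /hc].
Qed.

Lemma sum_ge1 (T : finType) (A : {set T}) (f : T -> nat) c i :
  (forall j, j \in A -> c <= f j) -> i \in A ->
  f i + c * #|A|.-1 <= \sum_(j in A) f j.
Proof.
move=> hc Ai; have := @sum_ge_subset _ A [set i] f c; rewrite sub1set big_set1 cards1 subn1.
exact.
Qed.

Lemma sum_ge2 (T : finType) (A : {set T}) (f : T -> nat) c i j :
  (forall j, j \in A -> c <= f j) -> i \in A -> j \in A -> i != j ->
  f i + f j + c * #|A|.-2 <= \sum_(k in A) f k.
Proof.
move=> hc Ai Aj ij; have := @sum_ge_subset _ A [set i; j] f c.
rewrite subUset !sub1set Ai Aj big_setU1 ?inE //= big_set1 cards2 ij subn2.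
exact.
Qed.

(** * The (10,4,2) coverings with nine blocks *)

Section Link.
Variables (X : finType) (F : {set {set X}}) (Y : {set X}).
Hypothesis cardY : #|Y| = 10.
Hypothesis card_block : forall b, b \in F -> #|b :&: Y| = 4.
Hypothesis mu_gt0 : forall z w, z \in Y -> w \in Y -> z != w -> 0 < cnt F [:: z; w].

Local Notation deg z := (cnt F [:: z]).
Local Notation mu z w := (cnt F [:: z; w]).

Lemma muC z w : mu z w = mu w z.
Proof. by apply: cnt_perm; apply/permP => p /=; rewrite addnCA. Qed.

(** Degrees are at least 3 by [deg_ge3], so [L] holds the points of least degree; they lie on no
    repeated pair ([mu_L]). *)
Local Notation L := [set z in Y | deg z == 3].
Local Notation D := [set z in Y | deg z != 3].

Lemma sum_deg : \sum_(z in Y) deg z = 4 * #|F|.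
Proof.
rewrite (cnt_sum_const (k := 4)) => [|b Fb _]; last exact: card_block.
by congr (_ * _); apply: eq_card => b; rewrite !inE andbT.
Qed.

Lemma sum_mu z : z \in Y -> \sum_(w in Y :\ z) mu z w = 3 * deg z.
Proof.
move=> Yz; under eq_bigr do rewrite muC.
apply: cnt_sum_const => b Fb /=; rewrite andbT => bz.
have := card_block Fb; rewrite (cardsD1 z) inE bz Yz => -[].
by move=> <-; apply: eq_card => w; rewrite !inE; case: eqP; rewrite ?andbF.
Qed.

Lemma cardYD1 z : z \in Y -> #|Y :\ z| = 9.
Proof. by move=> Yz; move: cardY; rewrite (cardsD1 z) Yz => -[]. Qed.

Lemma mu_ge1 z w : z \in Y -> w \in Y :\ z -> 1 <= mu z w.
Proof. by move=> Yz; rewrite !inE => /andP[wz Yw]; apply: mu_gt0; rewrite // eq_sym. Qed.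

Lemma deg_ge3 z : z \in Y -> 3 <= deg z.
Proof.
move=> Yz; have : \sum_(w in Y :\ z) 1 <= \sum_(w in Y :\ z) mu z w.
  by apply: leq_sum => w; apply: mu_ge1.
by rewrite sum1_card cardYD1 // sum_mu //; lia.
Qed.

(** The nine values [mu z _] are positive and sum to [3 * deg z]; the 8 stands for the points other
    than [w]. *)
Lemma mu_bound z w : z \in Y -> w \in Y -> z != w -> mu z w + 8 <= 3 * deg z.
Proof.
move=> Yz Yw zw; have Aw : w \in Y :\ z by rewrite !inE eq_sym zw.
by have := sum_ge1 (@mu_ge1 z ^~ Yz) Aw; rewrite cardYD1 // sum_mu // mul1n.
Qed.

Lemma mu_bound2 z w v : z \in Y -> w \in Y -> v \in Y -> z != w -> z != v -> w != v ->
  mu z w + mu z v + 7 <= 3 * deg z.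
Proof.
move=> Yz Yw Yv zw zv wv.
have Aw : w \in Y :\ z by rewrite !inE eq_sym zw.
have Av : v \in Y :\ z by rewrite !inE eq_sym zv.
by have := sum_ge2 (@mu_ge1 z ^~ Yz) Aw Av wv; rewrite cardYD1 // sum_mu // mul1n.
Qed.

Lemma mu_L p w : p \in L -> w \in Y -> p != w -> mu p w = 1.
Proof.
rewrite inE => /andP[Yp /eqP dp] Yw pw.
have := mu_bound Yp Yw pw; have := mu_gt0 Yp Yw pw; rewrite dp.
lia.
Qed.

Lemma mu_ge2_D z w : z \in Y -> w \in Y -> z != w -> 2 <= mu z w -> z \in D.
Proof.
move=> Yz Yw zw m2; rewrite inE Yz /=; apply/eqP => dz.
by move: m2; rewrite (@mu_L z w) // inE Yz dz.
Qed.

(* The three blocks through [p] partition the other points, so two of the four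
   points of [b] lie in the same one. *)
Lemma excess_pair p b : p \in L -> b \in F -> p \notin b ->
  exists z w, [/\ z \in b :&: D, w \in b :&: D, z != w & 2 <= mu z w].
Proof.
move=> Lp Fb npb.
have [Yp /eqP dp] : p \in Y /\ deg p == 3 by move: Lp; rewrite inE => /andP[].
pose C := [set c in F | all (mem c) [:: p]].
have pw z : z \in b :&: Y -> exists2 c, c \in C & z \in c.
  rewrite inE => /andP[bz Yz].
  have pz : p != z by apply: contraNneq npb => ->.
  have /cnt_gt0[c Fc /= /and3P[cp cz _]] := mu_gt0 Yp Yz pz.
  by exists c => //; rewrite inE Fc /= cp.
pose f z := odflt b [pick c in C | z \in c].
have fP z : z \in b :&: Y -> (f z \in C) && (z \in f z).
  move=> /pw[c Cc cz]; rewrite /f; case: pickP => [d /andP[-> ->] //|/(_ c)].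
  by rewrite Cc cz.
have /dinjectivePn[z bz [w]] : ~~ dinjectiveb f (mem (b :&: Y)).
  apply/dinjectiveP => /card_in_imset E.
  have : #|f @: (b :&: Y)| <= #|C|.
    by apply: subset_leq_card; apply/subsetP => _ /imsetP[z /fP/andP[? _] ->].
  by rewrite E card_block //  -[#|C|]/(deg p) dp.
rewrite !inE => /and3P[wz bw Yw] Ef.
have [Cz fz] := andP (fP _ bz); have [_ fw] := andP (fP _ (introT setIP (conj bw Yw))).
move: bz; rewrite inE => /andP[bz Yz].
have m2 : 2 <= mu z w.
  have := @subset_leq_card _ [set b; f z] [set c in F | all (mem c) [:: z; w]].
  rewrite cards2.
  have -> : b != f z.
    by apply: contraNneq npb => ->; move: Cz; rewrite !inE /= => /and3P[].
  apply; apply/subsetP => c; rewrite !inE /= => /orP[] /eqP->; first by rewrite Fb bz bw.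
  by rewrite fz Ef fw; move: Cz; rewrite Ef inE => /andP[->].
have zw : z != w by rewrite eq_sym.
exists z, w; split=> //; rewrite inE ?bz ?bw /=; first exact: mu_ge2_D m2.
by apply: mu_ge2_D Yw Yz wz _; rewrite muC.
Qed.


Lemma cardLD : #|L| + #|D| = 10.
Proof.
rewrite -[RHS]cardY -(cardsID [set z | deg z == 3] Y).
by congr (_ + _); apply: eq_card => z; rewrite !inE // andbC.
Qed.

Lemma sum_deg_D : 3 * #|L| + \sum_(z in D) deg z = 4 * #|F|.
Proof.
rewrite -sum_deg [RHS](bigID (fun z => deg z == 3)) /=; congr (_ + _).
  rewrite mulnC -sum_nat_const [RHS](eq_bigr (fun=> 3)) => [|z /andP[_ /eqP//]].
  by apply: eq_bigl => z; rewrite inE.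
by apply: eq_bigl => z; rewrite inE.
Qed.

Lemma deg_D_ge4 z : z \in D -> 4 <= deg z.
Proof. by rewrite inE => /andP[Yz d3]; have := deg_ge3 Yz; move/eqP: d3; lia. Qed.

Lemma card_block_LD b : b \in F -> #|b :&: L| + #|b :&: D| = 4.
Proof.
move=> Fb; rewrite -[RHS](card_block Fb) -(cardsID [set z | deg z == 3] (b :&: Y)).
congr (_ + _); apply: eq_card => z; rewrite !inE ?andbA //.
by rewrite -[RHS]andbA [RHS]andbC.
Qed.

(** A point of [L] outside [b] yields, by [excess_pair], two points of [D] among the four points of
    [b] in [Y]. *)
Lemma block_L2 b : b \in F -> ~~ (L \subset b) -> #|b :&: L| <= 2.
Proof.
move=> Fb /subsetPn[p Lp npb]; have [z [w [zb wb zw _]]] := excess_pair Lp Fb npb.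
have : #|[set z; w]| <= #|b :&: D|.
  by apply: subset_leq_card; rewrite subUset !sub1set zb.
by rewrite cards2 zw; have := card_block_LD Fb; lia.
Qed.

Lemma L_sub_block b : b \in F -> L \subset b -> #|L| <= 4.
Proof. by move=> Fb /setIidPr Lb; have := card_block_LD Fb; rewrite Lb; lia. Qed.

(** With at most eight blocks the degrees sum to at most 32, so [L] has at least 8 points and lies
    in no block. Every block then has at least two points in [D], and
    [2 * #|F| <= 4 * #|F| - 3 * #|L|] is impossible. *)
Lemma link_ge9 : 9 <= #|F|.
Proof.
rewrite leqNgt ltnS; apply/negP => F8.
have D4 : 4 * #|D| <= \sum_(z in D) deg z.
  by rewrite mulnC -sum_nat_const; apply: leq_sum => z; apply: deg_D_ge4.
have [c s] := (cardLD, sum_deg_D).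
have : 2 * #|F| <= \sum_(z in D) deg z.
  rewrite cnt_sum mulnC -sum_nat_const; rewrite [leqRHS](eq_bigl [in F]) => [|b]; last first.
    by rewrite andbT.
  apply: leq_sum => b Fb; have := card_block_LD Fb.
  have : #|b :&: L| <= 2; last by lia.
  by apply: block_L2 => //; apply/negP => /(L_sub_block Fb); lia.
by lia.
Qed.

Hypothesis cardF : #|F| = 9.

(** A degree of at least 5 forces [#|L| >= 5], so no block contains [L]. Each point of [L] lies in
    two of the at most four blocks missing [z], and each of these has at most two points of [L],
    whence [2 * #|L| <= 8]. *)
Lemma deg_le4 z : z \in Y -> deg z <= 4.
Proof.
move=> Yz; rewrite leqNgt; apply/negP => d5.
have Dz : z \in D by rewrite inE Yz; apply/eqP; lia.
have [[c s] D4] := (cardLD, sum_deg_D, sum_ge1 (fun w => @deg_D_ge4 w) Dz).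
have L5 : 5 <= #|L| by rewrite cardF in s; lia.
pose F0 := [set b in F | z \notin b].
have F0E : #|F0| + deg z = 9.
  rewrite -[RHS]cardF -(cardsID [set b : {set X} | z \in b] F) addnC; congr (_ + _).
    by apply: eq_card => b; rewrite !inE /= andbT.
  by apply: eq_card => b; rewrite !inE andbC.
have le : \sum_(p in L) cnt F0 [:: p] <= 2 * #|F0|.
  rewrite cnt_sum mulnC -sum_nat_const [leqLHS](eq_bigl [in F0]) => [|b]; last first.
    by rewrite andbT.
  apply: leq_sum => b; rewrite inE => /andP[Fb _]; apply: block_L2 => //.
  by apply/negP => /(L_sub_block Fb); lia.
have : \sum_(p in L) cnt F0 [:: p] = #|L| * 2.
  rewrite -sum_nat_const; apply: eq_bigr => p Lp.
  have [Yp /eqP dp] : p \in Y /\ deg p == 3 by move: Lp; rewrite inE => /andP[].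
  have pz : p != z by apply: contraTneq Lp => ->; move: Dz; rewrite !inE => /andP[->].
  have := mu_L Lp Yz pz; move: dp.
  rewrite /cnt -[#|[set b in F | _]|](cardsID [set b : {set X} | z \in b]).
  set a := #|_|; set b := #|_|; set m := #|[set b in F | all (mem b) [:: p; z]]|.
  have -> : a = m by apply: eq_card => d; rewrite !inE /= !andbT andbA.
  have -> : #|[set b in F0 | all (mem b) [:: p]]| = b.
    by apply: eq_card => d; rewrite !inE /= !andbT; do ![case: (_ \in _)].
  by lia.
by lia.
Qed.

Lemma deg_D z : z \in D -> deg z = 4.
Proof.
move=> Dz; have := deg_D_ge4 Dz; have : z \in Y by move: Dz; rewrite inE => /andP[].
by move/deg_le4; lia.
Qed.

Lemma card_L : #|L| = 4.
Proof.
have [] := (cardLD, sum_deg_D).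
by rewrite cardF (eq_bigr (fun=> 4)) ?sum_nat_const => [|z /deg_D//]; lia.
Qed.

Lemma card_D : #|D| = 6.
Proof. by have := cardLD; rewrite card_L => -[]. Qed.


Lemma LY p : p \in L -> p \in Y.
Proof. by rewrite inE => /andP[]. Qed.

Lemma DY z : z \in D -> z \in Y.
Proof. by rewrite inE => /andP[]. Qed.

Lemma LD_neq p z : p \in L -> z \in D -> p != z.
Proof. by rewrite !inE => /andP[_ p3] /andP[_ z3]; apply: contraNneq z3 => <-. Qed.

Lemma deg_L p : p \in L -> deg p = 3.
Proof. by rewrite inE => /andP[_ /eqP]. Qed.

Lemma mu_LD p z : p \in L -> z \in D -> mu p z = 1.
Proof. by move=> Lp Dz; apply: mu_L (DY Dz) (LD_neq Lp Dz). Qed.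

Lemma L_block_eq p q b c : p \in L -> q \in L -> p != q -> b \in F -> c \in F ->
  p \in b -> q \in b -> p \in c -> q \in c -> b = c.
Proof.
move=> Lp Lq pq Fb Fc pb qb pc qc; apply: cnt_uniq (mu_L Lp (LY Lq) pq) _ _ _ _ => //=.
  by rewrite pb qb.
by rewrite pc qc.
Qed.

Lemma sum_block_L z : z \in D -> \sum_(b in F | z \in b) #|b :&: L| = 4.
Proof.
move=> Dz; rewrite (eq_bigl (fun b : {set X} => (b \in F) && all (mem b) [:: z])); last first.
  by move=> b /=; rewrite andbT.
rewrite -cnt_sum (eq_bigr (fun=> 1)) => [|p Lp]; last exact: mu_LD.
by rewrite sum1_card card_L.
Qed.

(** Of the total [3 * deg z = 12], the four points of [L] take 1 each. *)
Lemma sum_mu_D z : z \in D -> \sum_(w in D :\ z) mu z w = 8.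
Proof.
move=> Dz; have := sum_mu (DY Dz); rewrite deg_D // (big_setID L) /=.
rewrite (eq_bigr (fun=> 1)) => [|p]; last first.
  rewrite inE => /andP[/setD1P[pz _] Lp]; rewrite muC; exact: mu_LD.
rewrite sum1_card.
have -> : (Y :\ z) :&: L = L.
  by apply/setIidPr/subsetP => p Lp; rewrite !inE (LD_neq Lp Dz) LY.
have -> : (Y :\ z) :\: L = D :\ z.
  by apply/setP => w; rewrite !inE; case: (w \in Y); rewrite /= ?andbF ?andbT // andbC.
by rewrite card_L; lia.
Qed.

Lemma card_D1 z : z \in D -> #|D :\ z| = 5.
Proof. by move=> Dz; have := card_D; rewrite (cardsD1 z) Dz => -[]. Qed.

Lemma mu_le4 z w : z \in D -> mu z w <= 4.
Proof. by move=> Dz; rewrite -(deg_D Dz); apply: cnt_sub => v; rewrite !inE => ->. Qed.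

(** * Type A: some block contains [L] *)

Section TypeA.
Variable c0 : {set X}.
Hypotheses (Fc0 : c0 \in F) (Lc0 : L \subset c0).

Lemma typeA_block_disjoint z : z \in D -> z \notin c0.
Proof.
move=> Dz; apply/negP => zc0; have := card_block_LD Fc0.
rewrite (setIidPr Lc0) card_L => -[/eqP]; rewrite cards_eq0 => /eqP E.
by have : z \in c0 :&: D by [apply/setIP]; rewrite E inE.
Qed.

(** Two points of [L] in [b] would force [b = c0], which misses [D]. The four blocks through [z]
    meet [L] four times in total, so none of them can miss it. *)
Lemma typeA_block1 b z : b \in F -> z \in D -> z \in b -> #|b :&: L| = 1.
Proof.
move=> Fb Dz zb.
have le1 c : c \in F -> z \in c -> #|c :&: L| <= 1.
  move=> Fc zc; rewrite leqNgt; apply/negP => /card_gt1P[p [q []]].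
  rewrite !inE => /andP[pc /andP[Yp p3]] /andP[qc /andP[Yq q3]] pq.
  have Lp : p \in L by rewrite inE Yp.
  have Lq : q \in L by rewrite inE Yq.
  have E : c = c0 by apply: L_block_eq pq _ _ _ _ _ _ => //; apply: (subsetP Lc0).
  by move: (typeA_block_disjoint Dz); rewrite -E zc.
have s1 : \sum_(c in F | z \in c) 1 = 4.
  by rewrite sum1_card -(deg_D Dz); apply: eq_card => c; rewrite !inE /= andbT.
have : \sum_(c in F | z \in c) (1 - #|c :&: L|) == 0.
  by rewrite sumnB ?s1 ?sum_block_L // => c /andP[]; apply: le1.
rewrite sum_nat_eq0 => /forall_inP/(_ b); rewrite Fb zb => /(_ isT)/eqP.
by have := le1 b Fb zb; lia.
Qed.

Lemma mu_sum_L z w : z \in D -> mu z w = \sum_(l in L) cnt F [:: l; z; w].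
Proof.
move=> Dz; rewrite (cnt_sum_const (k := 1)) ?mul1n // => b Fb /= /and3P[zb _ _].
exact: typeA_block1 Dz zb.
Qed.

Lemma L_block_D l z : l \in L -> z \in D ->
  exists2 b, b \in [set b in F | l \in b] :\ c0 & z \in b /\
    forall w, cnt F [:: l; z; w] = (w \in b).
Proof.
move=> Ll Dz; have m1 := mu_LD Ll Dz.
have /cnt_gt0[b Fb /= /and3P[lb zb _]] : 0 < cnt F [:: l; z] by rewrite m1.
exists b; first by rewrite !inE Fb lb !andbT; apply: contraNneq (typeA_block_disjoint Dz) => <-.
split=> // w; case wb : (w \in b).
  have le1 : cnt F [:: l; z; w] <= mu l z.
    by apply: cnt_sub => v; rewrite !inE => /orP[] ->; rewrite ?orbT.
  apply/eqP; rewrite eqn_leq -[nat_of_bool _]m1 le1 m1 /=.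
  by apply/cnt_gt0; exists b; rewrite //= lb zb wb.
apply/eqP; rewrite -leqn0 leqNgt; apply/cnt_gt0 => -[c Fc /= /and4P[lc zc wc _]].
suff E : c = b by rewrite -E wc in wb.
by apply: (cnt_uniq m1); rewrite //= ?lc ?lb ?zc ?zb.
Qed.

(* Apart from the block containing [L], each point of [L] lies in two blocks,
   which split [D] in two parts. *)
Lemma mu_parity z w v : z \in D -> w \in D -> v \in D ->
  ~~ odd (mu z w + mu w v + mu z v).
Proof.
move=> Dz Dw Dv; rewrite !mu_sum_L // -!big_split /=.
pose g l := cnt F [:: l; z; w] + cnt F [:: l; w; v] + cnt F [:: l; z; v].
have : \sum_(l in L) odd (g l) = 4.
  rewrite -card_L -sum1_card; apply: eq_bigr => l Ll; rewrite /g.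
  have [bz Cz [zbz Ez]] := L_block_D Ll Dz; have [bw Cw [wbw Ew]] := L_block_D Ll Dw.
  have [bv Cv [vbv Ev]] := L_block_D Ll Dv.
  have C2 : #|[set b in F | l \in b] :\ c0| = 2.
    apply/eqP; rewrite -(eqn_add2l 1); apply/eqP; have := deg_L Ll.
    rewrite /cnt (cardsD1 c0) !inE Fc0 /= (subsetP Lc0) //= => -[] <-.
    by congr (_ + _); apply: eq_card => c; rewrite !inE /= andbT.
  have eqb (b c : {set X}) x : b \in [set b in F | l \in b] :\ c0 ->
      c \in [set b in F | l \in b] :\ c0 -> x \in D -> x \in c -> (x \in b) = (b == c).
    move=> Cb Cc Dx xc; apply/idP/eqP => [xb|-> //].
    move: Cb Cc; rewrite !inE => /and3P[_ Fb lb] /and3P[_ Fc lc].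
    by apply: (cnt_uniq (mu_LD Ll Dx)); rewrite //= ?lb ?xb ?lc ?xc.
  rewrite !Ez Ew (eqb bz bw w) // (eqb bw bv v) // (eqb bz bv v) //.
  (* Three points lie in only two blocks, so one or three of their pairs agree. Hence [g l] is odd
     for each of the four [l], and the whole sum is even. *)
  have : ~~ uniq [:: bz; bw; bv].
    apply/negP => /card_uniqP E; suff : 3 <= 2 by [].
    rewrite -[X in X <= _]E -C2; apply: subset_leq_card; apply/subsetP => c.
    by rewrite !inE => /or3P[] /eqP->; move: Cz Cw Cv; rewrite !inE.
  rewrite /= !inE; case: (eqVneq bz bw) => [->|nzw]; first by case: (bw == bv).
  by case: (eqVneq bw bv) => [<-|_] /=; rewrite ?(negPf nzw) //; case: (bz == bv).
move=> E; have -> : odd (\sum_(l in L) g l) = odd (\sum_(l in L) odd (g l)).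
  by apply: (big_ind2 (fun a b => odd a = odd b)) => // [a b c d|l _]; rewrite ?oddD ?oddb // => -> ->.
by rewrite E.
Qed.


(** For each of the other four points [t] of [D], parity makes [mu z t + mu w t] odd, hence at least
    3. This needs 12, but only [5 + 5] is left beside [mu z w = 3]. *)
Lemma typeA_mu3 z w : z \in D -> w \in D -> z != w -> mu z w != 3.
Proof.
move=> Dz Dw zw; apply/eqP => m3.
have Aw : w \in D :\ z by apply/setD1P; rewrite eq_sym.
have Az : z \in D :\ w by apply/setD1P.
have := sum_mu_D Dz; rewrite (big_setD1 w) //= m3 => s1.
have := sum_mu_D Dw; rewrite (big_setD1 z) //= muC m3 => s2.
have E : (D :\ w) :\ z = (D :\ z) :\ w.
  by rewrite !setDDl setUC.
rewrite E in s2.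
have : \sum_(t in (D :\ z) :\ w) 3 <= \sum_(t in (D :\ z) :\ w) (mu z t + mu w t).
  apply: leq_sum => t /setD1P[tw /setD1P[tz Dt]].
  have := mu_parity Dz Dw Dt; rewrite m3.
  have := mu_gt0 (DY Dz) (DY Dt); rewrite eq_sym tz => /(_ isT).
  have := mu_gt0 (DY Dw) (DY Dt); rewrite eq_sym tw => /(_ isT).
  by move: (mu w t) (mu z t) => a b; clear; lia.
have : #|(D :\ z) :\ w| = 4 by have := card_D1 Dz; rewrite (cardsD1 w) Aw => -[].
by rewrite big_split sum_nat_const /= => ->; move: s1 s2; clear; lia.
Qed.

(** A point of [D] on no pair of count 4 has, by [sum_mu_D], three neighbours of count 2. Parity
    turns these four points into the K4 [K], and degree 4 leaves count 1 from [K] to all other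
    points. So [mu u w = 8 - 4] for the last two points: the triple edge. *)
Lemma typeA_struct : exists (K : {set X}) (u w : X),
  [/\ K \subset D, #|K| = 4, D :\: K = [set u; w], u != w &
  [/\ {in K &, forall a b, a != b -> mu a b = 2},
      {in K & Y :\: K, forall a b, mu a b = 1} & mu u w = 4]].
Proof.
case: (pickP (fun z => (z \in D) && [forall w in D :\ z, mu z w != 4])) => [z|none].
  move=> /andP[Dz /forall_inP n4].
  have m12 w : w \in D :\ z -> mu z w = 1 + (mu z w == 2).
    move=> Aw; have := n4 w Aw; move: Aw => /setD1P[wz Dw].
    have zw : z != w by rewrite eq_sym.
    have := typeA_mu3 Dz Dw zw; have := mu_le4 w Dz.
    have := mu_gt0 (DY Dz) (DY Dw) zw.
    by case: (mu z w) => [|[|[|[|[]]]]].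
  pose N := [set w in D :\ z | mu z w == 2].
  have cN : #|N| = 3.
    have := sum_mu_D Dz; rewrite (eq_bigr _ m12) big_split /= sum1_card card_D1 //.
    rewrite -big_mkcondr /= sum1_card => -[<-].
    by apply: eq_card => w; rewrite [LHS]inE.
  have ND w : w \in N -> w \in D by move=> /setIdP[/setD1P[]].
  have zN : z \notin N by apply/negP => /setIdP[/setD1P[/eqP]].
  have NE w : w \in N -> mu z w = 2 by move=> /setIdP[_ /eqP].
  have NN a b : a \in N -> b \in N -> a != b -> mu a b = 2.
    move=> Na Nb ab; have := mu_parity Dz (ND _ Na) (ND _ Nb); rewrite !NE //.
    have za : a != z by apply: contraNneq zN => <-.
    have zb : z != b by apply: contraNneq zN => ->.
    have := mu_bound2 (DY (ND _ Na)) (DY Dz) (DY (ND _ Nb)) za ab zb.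
    rewrite deg_D ?ND // muC NE //.
    have := mu_gt0 (DY (ND _ Na)) (DY (ND _ Nb)) ab.
    by move: (mu a b) => m; clear; lia.
  pose K := z |: N.
  have cK : #|K| = 4 by rewrite cardsU1 zN cN.
  have KD : K \subset D by rewrite subUset sub1set Dz; apply/subsetP.
  have KK a b : a \in K -> b \in K -> a != b -> mu a b = 2.
    move=> /setU1P[->|Na] /setU1P[->|Nb].
    - by rewrite eqxx.
    - by move=> _; apply: NE.
    - by move=> _; rewrite muC; apply: NE.
    - exact: NN.
  have KC a b : a \in K -> b \in Y :\: K -> mu a b = 1.
    move=> Ka /setDP[Yb nKb]; have Da := subsetP KD _ Ka.
    have Aw : K :\ a \subset Y :\ a by apply: setSD; apply: subset_trans KD _; apply/subsetP => ? /DY.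
    have ba : b != a by apply: contraNneq nKb => ->.
    have Ab : b \notin K :\ a by rewrite inE negb_and nKb orbT.
    have AC : b |: K :\ a \subset Y :\ a.
      by rewrite subUset sub1set Aw !inE ba Yb.
    have := sum_ge_subset AC (@mu_ge1 a ^~ (DY Da)).
    rewrite sum_mu ?DY // deg_D // big_setU1 //= cardsU1 Ab cardYD1 ?DY //.
    have -> : #|K :\ a| = 3 by have := cK; rewrite (cardsD1 a) Ka => -[].
    rewrite (eq_bigr (fun=> 2)) => [|c /setD1P[ca Kc]]; last by rewrite KK // eq_sym.
    rewrite sum_nat_const; have -> : #|K :\ a| = 3 by have := cK; rewrite (cardsD1 a) Ka => -[].
    have := mu_gt0 (DY Da) Yb; rewrite eq_sym ba => /(_ isT).
    by move: (mu a b) => m; clear; lia.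
  have /eqP/cards2P[u [w [uw E]]] : #|D :\: K| = 2.
    by have := cardsD D K; rewrite (setIidPr KD) card_D cK.
  have : u \in D :\: K by rewrite E !inE eqxx.
  have : w \in D :\: K by rewrite E !inE eqxx orbT.
  move=> /setDP[Dw nKw] /setDP[Du nKu].
  exists K, u, w; split=> //; split=> //.
  have := sum_mu_D Du; rewrite (big_setD1 w) /=; last by rewrite in_setD1 eq_sym uw.
  rewrite (eq_bigr (fun=> 1)) => [|v]; last first.
    move=> /setD1P[vw /setD1P[vu Dv]]; rewrite muC; apply: KC.
      apply: contraTT Dv => nKv; have : v \notin D :\: K by rewrite E !inE negb_or vu.
      by apply: contra => Dv; apply/setDP.
    by rewrite inE nKu DY.
  have -> : D :\ u :\ w = K.
    by rewrite setDDl -[[set u] :|: _]/[set u; w] -E setDDr setDv set0U; apply/setIidPr.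
  by rewrite sum1_card cK => /eqP; rewrite -[8]/(4 + 4) eqn_add2r => /eqP.
(* Otherwise pairs of count 4 match up [D], with count 1 elsewhere in [D]. Three points, no two of
   them matched, then have total [1 + 1 + 1], against [mu_parity]. *)
have partner z : z \in D -> exists w, [/\ w \in D, w != z & mu z w = 4].
  move=> Dz; have := none z; rewrite Dz /= => /negbT/forall_inPn[w /setD1P[wz Dw] /negPn/eqP m4].
  by exists w.
have m1 z w v : z \in D -> w \in D -> v \in D -> z != w -> mu z w = 4 -> v != z -> v != w -> mu z v = 1.
  move=> Dz Dw Dv zw m4 vz vw; rewrite eq_sym in vz.
  have wv : w != v by rewrite eq_sym.
  have := mu_bound2 (DY Dz) (DY Dw) (DY Dv) zw vz wv.
  have := mu_gt0 (DY Dz) (DY Dv) vz.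
  by rewrite deg_D // m4; move: (mu z v) => m; clear; lia.
have more (A : {set X}) : #|A| < 6 -> exists2 t, t \in D & t \notin A.
  move=> A6; have /subsetPn[t] : ~~ (D \subset A); last by exists t.
  by apply: contraL A6 => /subset_leq_card; rewrite card_D -leqNgt.
have /card_gt0P[z Dz] : 0 < #|D| by rewrite card_D.
have [w [Dw wz mzw]] := partner z Dz.
have [|t Dt] := more [set z; w]; first by rewrite cards2; case: (z != w).
rewrite !inE negb_or => /andP[tz tw].
have [t' [Dt' t't mtt']] := partner t Dt.
have [|s Ds] := more (t' |: (t |: [set z; w])).
  by rewrite !cardsU1 cards1; do ![case: (_ \in _)].
rewrite !inE !negb_or => /and4P[st' st sz sw].
rewrite eq_sym in wz; rewrite eq_sym in t't.
by have := mu_parity Dz Dt Ds; rewrite (m1 z w t) // (m1 z w s) // (m1 t t' s).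
Qed.

End TypeA.

(** * Type B: no block contains [L] *)

Section TypeB.
Hypothesis noL : forall b, b \in F -> ~~ (L \subset b).

(** Over the three blocks through [l], the sizes of the traces on [L] sum to 6: [l] counts three
    times, the other three points once each. No trace exceeds 2. *)
Lemma typeB_block b l : b \in F -> l \in L -> l \in b -> #|b :&: L| = 2.
Proof.
move=> Fb Ll lb.
have le2 c : c \in F -> #|c :&: L| <= 2 by move=> Fc; apply: block_L2 (noL Fc).
have s2 : \sum_(c in F | l \in c) 2 = 6.
  rewrite sum_nat_const -[6]/(3 * 2) -(deg_L Ll); congr (_ * _).
  by apply: eq_card => c; rewrite !inE /= andbT.
have s : \sum_(c in F | l \in c) #|c :&: L| = 6.
  rewrite (eq_bigl (fun c : {set X} => (c \in F) && all (mem c) [:: l])); last first.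
    by move=> c /=; rewrite andbT.
  rewrite -cnt_sum (bigD1 l) //= (eq_bigr (fun=> 1)) => [|p /andP[Lp pl]]; last first.
    exact: mu_L (LY Ll) pl.
  have -> : cnt F [:: l; l] = 3.
    by rewrite -(deg_L Ll); apply: eq_card => c; rewrite !inE /= !andbT andbb.
  rewrite sum1_card (eq_card (B := [predD1 L & l])) => [|p]; last by rewrite [RHS]inE [RHS]andbC.
  by have := card_L; rewrite (cardD1 l) Ll -[4]/(true + 3) => /addnI ->.
have : \sum_(c in F | l \in c) (2 - #|c :&: L|) == 0.
  by rewrite sumnB ?s2 ?s // => c /andP[/le2].
rewrite sum_nat_eq0 => /forall_inP/(_ b); rewrite Fb lb => /(_ isT)/eqP.
by have := le2 b Fb; lia.
Qed.

Local Notation H := [set b in F | b :&: L == set0].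

Lemma typeB_block_on_L b : b \in F -> b \notin H -> #|b :&: L| = 2.
Proof.
move=> Fb; rewrite inE Fb /= => /set0Pn[l /setIP[lb Ll]]; exact: typeB_block lb.
Qed.

Lemma card_blocks_off_L : #|H| = 3.
Proof.
have : \sum_(l in L) cnt F [:: l] = 12.
  by rewrite (eq_bigr (fun=> 3)) => [|l /deg_L//]; rewrite sum_nat_const card_L.
rewrite cnt_sum (eq_bigl [in F]) => [|b]; last by rewrite andbT.
rewrite (big_setID H) /= big1 => [|b /setIP[_]]; last first.
  by rewrite inE => /andP[_ /eqP->]; rewrite cards0.
rewrite (eq_bigr (fun=> 2)) => [|b /setDP[]]; last exact: typeB_block_on_L.
have /setIidPr HF : H \subset F by apply/subsetP => b; rewrite inE => /andP[].
by rewrite sum_nat_const cardsD HF cardF; set h := #|H|; lia.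
Qed.

Lemma card_blocks_on_L_at z : z \in D -> #|[set b in F :\: H | z \in b]| = 2.
Proof.
move=> Dz; have := sum_block_L Dz; rewrite (bigID [in H]) /= big1 => [|b]; last first.
  by move=> /andP[_]; rewrite inE => /andP[_ /eqP->]; rewrite cards0.
rewrite (eq_bigr (fun=> 2)) => [|b /andP[/andP[Fb _] nHb]]; last exact: typeB_block_on_L.
rewrite sum_nat_const add0n.
rewrite (eq_card (B := [set b in F :\: H | z \in b])) => [|b]; last first.
  by rewrite [LHS]unfold_in /= !inE; do ![case: (_ \in _)]; case: (_ == _).
by set h := #|_|; lia.
Qed.

Lemma card_blocks_off_L_at z : z \in D -> #|[set b in H | z \in b]| = 2.
Proof.
move=> Dz; have := deg_D Dz; have := card_blocks_on_L_at Dz.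
have -> : deg z = #|[set b in H | z \in b]| + #|[set b in F :\: H | z \in b]|.
  rewrite -[LHS](cardsID H); congr (_ + _); apply: eq_card => b; rewrite !inE /= andbT.
    by do ![case: (_ \in _)]; case: (_ == set0).
  by do ![case: (_ \in _)]; case: (_ == set0).
by move=> ->; lia.
Qed.

Lemma typeB_block_compl z b c : z \in D -> b \in F :\: H -> c \in F :\: H -> b != c ->
  z \in b -> z \in c -> c :&: L = L :\: b.
Proof.
move=> Dz /setDP[Fb nHb] /setDP[Fc nHc] bc zb zc.
apply/eqP; rewrite eqEcard (typeB_block_on_L Fc) // cardsD card_L [L :&: b]setIC typeB_block_on_L // andbT.
apply/subsetP => l /setIP[lc Ll]; rewrite inE Ll andbT; apply: contra bc => lb.
by apply/eqP; apply: (cnt_uniq (mu_LD Ll Dz)); rewrite //= ?lb ?zb ?lc ?zc.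
Qed.

(** Two blocks through [z] meet [L]; let [w] be the other point of [D] in the first one. By
    [typeB_block_compl] the other block through [w] that meets [L] has the same two points of [L] as
    the second one, so they coincide. A third common block is found among the three that miss [L],
    since [z] and [w] lie in two of them each. *)
Lemma typeB_mu3 z : z \in D -> exists w, [/\ w \in Y, w != z & 3 <= mu z w].
Proof.
move=> Dz; have /eqP/cards2P[b1 [b2 [b12 E]]] := card_blocks_on_L_at Dz.
have : b1 \in [set b in F :\: H | z \in b] by rewrite E !inE eqxx.
have : b2 \in [set b in F :\: H | z \in b] by rewrite E !inE eqxx orbT.
rewrite in_set => /andP[G2 zb2]; rewrite in_set => /andP[G1 zb1].
have [F1 nH1] := setDP G1; have [F2 nH2] := setDP G2.
have /card_gt1P[w' [w'' [Dw' Dw'' w'w'']]] : 1 < #|b1 :&: D|.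
  by have := card_block_LD F1; rewrite (typeB_block_on_L F1) // -[4]/(2 + 2) => /addnI ->.
have [w [Dw wz wb1]] : exists w, [/\ w \in D, w != z & w \in b1].
  move: Dw' Dw''; rewrite !in_setI => /andP[? ?] /andP[? ?].
  by case: (eqVneq w' z) w'w'' => [->|? _]; [exists w''; rewrite eq_sym|exists w'].
have [c Gc [cb1 wc]] : exists2 c, c \in F :\: H & c != b1 /\ w \in c.
  have : 1 < #|[set b in F :\: H | w \in b]| by rewrite card_blocks_on_L_at.
  case/card_gt1P => c [d []]; rewrite [c \in _]in_set [d \in _]in_set => /andP[Gc wc] /andP[Gd wd] cd.
  case: (eqVneq c b1) cd => [->|cb1 _]; last by exists c.
  by move=> ?; exists d; rewrite // eq_sym.
have {c Gc cb1 wc} wb2 : w \in b2.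
  suff <- : c = b2 by [].
  have b1c : b1 != c by rewrite eq_sym.
  have Ec := typeB_block_compl Dw G1 Gc b1c wb1 wc; have E2 := typeB_block_compl Dz G1 G2 b12 zb1 zb2.
  have /card_gt1P[p [q []]] : 1 < #|b2 :&: L| by rewrite typeB_block_on_L.
  move=> /setIP[p2 Lp] /setIP[q2 Lq] pq.
  have : p \in c :&: L by rewrite Ec -E2 inE p2.
  have : q \in c :&: L by rewrite Ec -E2 inE q2.
  by move=> /setIP[qc _] /setIP[pc _]; apply: L_block_eq pq _ _ _ _ _ _; rewrite // (setDP Gc).1.
exists w; split=> //; first exact: DY.
have : 0 < #|[set b in H | z \in b] :&: [set b in H | w \in b]|.
  have := cardsUI [set b in H | z \in b] [set b in H | w \in b]; rewrite !card_blocks_off_L_at //.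
  have : #|[set b in H | z \in b] :|: [set b in H | w \in b]| <= #|H|; last first.
    by rewrite card_blocks_off_L; case: #|_ :&: _| => // le; rewrite addn0 => E'; rewrite E' in le.
  by apply: subset_leq_card; apply/subsetP => b /setUP[]; rewrite in_set => /andP[].
case/card_gt0P => c /setIP[]; rewrite in_set => /andP[Hc zc]; rewrite in_set => /andP[_ wc].
have nc b : b \in F :\: H -> b != c by move=> /setDP[_]; apply: contraNneq => ->.
have c3 : #|[set b1; b2; c]| = 3 by rewrite -setUA cardsU1 cards2 in_set2 negb_or b12 !nc.
rewrite -c3 /cnt; apply: subset_leq_card; apply/subsetP => b; rewrite !inE /= andbT => /orP[/orP[]|] /eqP->.
- by rewrite F1 zb1.
- by rewrite F2 zb2.
- by move: Hc; rewrite inE zc wc => /andP[->].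
Qed.

End TypeB.
End Link.

(** * A (12,6,4) covering has at least 41 blocks *)

(** Nonzero terms come from triples of distinct entries, whose rotations form orbits of exactly
    three. *)
Lemma dvdn3_sum_cyclic (T : finType) (f : T -> T -> T -> nat) :
  (forall x y z, f x y z = f y z x) -> (forall x y z, ~~ uniq [:: x; y; z] -> f x y z = 0) ->
  3 %| \sum_x \sum_y \sum_z f x y z.
Proof.
move=> rot uniq0; pose r := @enum_rank T.
(* [g] keeps the triples whose first entry is the least of the three. *)
pose g x y z := ((r x < r y) && (r x < r z)) * f x y z.
have E x y z : f x y z = g x y z + g y z x + g z x y.
  rewrite /g -(rot x y z) (rot z x y); case u : (uniq [:: x; y; z]); last by rewrite uniq0 ?u ?muln0.
  move: u; rewrite /= !inE negb_or andbT => /andP[/andP[xy xz] yz].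
  have rn (a b : T) : a != b -> nat_of_ord (r a) != r b.
    by apply: contra => /eqP/val_inj/enum_rank_inj ->.
  have := rn _ _ xy; have := rn _ _ xz; have := rn _ _ yz; set k := f x y z.
  by move: (nat_of_ord (r x)) (nat_of_ord (r y)) (nat_of_ord (r z)) => a b c;
     case: (ltngtP a b); case: (ltngtP a c); case: (ltngtP b c) => //=; lia.
have -> : \sum_x \sum_y \sum_z f x y z = 3 * \sum_x \sum_y \sum_z g x y z.
  transitivity (\sum_x \sum_y \sum_z g x y z + \sum_x \sum_y \sum_z g y z x
                + \sum_x \sum_y \sum_z g z x y).
    rewrite -!big_split; apply: eq_bigr => x _; rewrite -!big_split; apply: eq_bigr => y _.
    by rewrite -!big_split; apply: eq_bigr => z _.
  have -> : \sum_x \sum_y \sum_z g y z x = \sum_x \sum_y \sum_z g x y z.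
    by rewrite exchange_big; apply: eq_bigr => y _; rewrite exchange_big.
  have -> : \sum_x \sum_y \sum_z g z x y = \sum_x \sum_y \sum_z g x y z.
    by under eq_bigr => x _ do rewrite exchange_big /=; rewrite exchange_big.
  by lia.
exact: dvdn_mulr.
Qed.

Section Cover12.
Variables (X : finType) (B : {set {set X}}).
Hypothesis cardX : #|X| = 12.
Hypothesis block6 : forall b, b \in B -> #|b| = 6.
Hypothesis cover4 : forall S : {set X}, #|S| = 4 -> exists2 b, b \in B & S \subset b.
Hypothesis le40 : #|B| <= 40.

Local Notation lam s := (cnt B s).

Lemma lam_gt0 x y z w : uniq [:: x; y; z; w] -> 0 < lam [:: x; y; z; w].
Proof.
move=> u; have [|b Bb /subsetP sb] := @cover4 [set t in [:: x; y; z; w]].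
  by rewrite cardsE; apply/card_uniqP.
by apply/cnt_gt0; exists b => //; apply/allP => t tl; apply: sb; rewrite inE.
Qed.

(** Blocks keep the points [x] and [y]: the results on (10,4,2) coverings only look at traces on the
    other ten points. *)
Definition link x y := [set b in B | (x \in b) && (y \in b)].

Lemma cnt_link x y s : cnt (link x y) s = lam (x :: y :: s).
Proof. by apply: eq_card => b; rewrite !inE /= !andbA. Qed.

Lemma card_link x y : #|link x y| = lam [:: x; y].
Proof. by apply: eq_card => b; rewrite !inE /= andbT. Qed.

Section LinkFacts.
Variables x y : X.
Hypothesis xy : x != y.

Local Notation Y := (~: [set x; y]).

Lemma inY z : (z \in Y) = (z != x) && (z != y).
Proof. by rewrite !inE negb_or. Qed.

Lemma cardY : #|Y| = 10.
Proof. by rewrite cardsCs setCK cardX cards2 xy. Qed.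

Lemma link_block4 b : b \in link x y -> #|b :&: Y| = 4.
Proof.
rewrite inE => /and3P[Bb xb yb]; rewrite -setDE cardsD (block6 Bb) (setIidPr _) ?cards2 ?xy //.
by rewrite subUset !sub1set xb.
Qed.

Lemma link_cover z w : z \in Y -> w \in Y -> z != w -> 0 < cnt (link x y) [:: z; w].
Proof.
rewrite !inY cnt_link => /andP[zx zy] /andP[wx wy] zw; apply: lam_gt0.
by rewrite /= !inE !negb_or xy zw ![x == _]eq_sym ![y == _]eq_sym zx zy wx wy.
Qed.

Lemma lam2_ge9 : 9 <= lam [:: x; y].
Proof. by rewrite -card_link; apply: (link_ge9 cardY link_block4 link_cover). Qed.

Lemma lam3_ge3 z : z != x -> z != y -> 3 <= lam [:: x; y; z].
Proof.
move=> zx zy; rewrite -cnt_link; apply: (deg_ge3 cardY link_block4 link_cover).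
by rewrite inY zx.
Qed.

Lemma lam4_bound z w : z \in Y -> w \in Y -> z != w ->
  lam [:: x; y; z; w] + 8 <= 3 * lam [:: x; y; z].
Proof. by rewrite -!cnt_link; apply: (mu_bound cardY link_block4 link_cover). Qed.

Lemma lam4_bound2 z w v : z \in Y -> w \in Y -> v \in Y -> z != w -> z != v -> w != v ->
  lam [:: x; y; z; w] + lam [:: x; y; z; v] + 7 <= 3 * lam [:: x; y; z].
Proof. by rewrite -!cnt_link; apply: (mu_bound2 cardY link_block4 link_cover). Qed.

Lemma sum_lam3 : \sum_(z in Y) lam [:: x; y; z] = 4 * lam [:: x; y].
Proof.
rewrite -card_link -(sum_deg link_block4); by apply: eq_bigr => z _; rewrite cnt_link.
Qed.

Lemma sum_lam4 z : z \in Y -> \sum_(w in Y :\ z) lam [:: x; y; z; w] = 3 * lam [:: x; y; z].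
Proof.
move=> Yz; rewrite -cnt_link -(sum_mu link_block4 Yz).
by apply: eq_bigr => w _; rewrite cnt_link.
Qed.

End LinkFacts.

Lemma lam_swap x y s : lam (x :: y :: s) = lam (y :: x :: s).
Proof. by apply: cnt_perm; apply/permP => p /=; lia. Qed.

Lemma lam_rot3 x y z s : lam (x :: y :: z :: s) = lam (y :: z :: x :: s).
Proof. by apply: cnt_perm; apply/permP => p /=; lia. Qed.

Lemma lam_swap23 x y z s : lam (x :: y :: z :: s) = lam (x :: z :: y :: s).
Proof. by apply: cnt_perm; apply/permP => p /=; lia. Qed.

Lemma lam_swap34 x y z w : lam [:: x; y; z; w] = lam [:: x; y; w; z].
Proof. by apply: cnt_perm; apply/permP => p /=; lia. Qed.

Lemma lam_rot234 x y z w : lam [:: x; y; z; w] = lam [:: x; z; w; y].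
Proof. by apply: cnt_perm; apply/permP => p /=; lia. Qed.

Lemma lam_rot4 x y z w : lam [:: x; y; z; w] = lam [:: w; x; y; z].
Proof. by apply: cnt_perm; apply/permP => p /=; lia. Qed.

(** * Blocks through one or two points, and partners *)

Lemma sum_lam2 x : \sum_(y in [set~ x]) lam [:: x; y] = 5 * lam [:: x].
Proof.
under eq_bigr do rewrite lam_swap.
apply: cnt_sum_const => b Bb /= /andP[xb _].
have := block6 Bb; rewrite (cardsD1 x) xb => -[<-].
by apply: eq_card => y; rewrite !inE andbC.
Qed.

Lemma cardC1_12 (x : X) : #|[set~ x]| = 11.
Proof. by rewrite cardsC1 cardX. Qed.

Lemma lam2_ge9_setC1 x y : y \in [set~ x] -> 9 <= lam [:: x; y].
Proof. by rewrite !inE eq_sym; apply: lam2_ge9. Qed.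

(** The eleven pairs at [x] give [5 * lam [:: x] >= 99]; the quotient is rounded up. *)
Lemma lam1_ge20 x : 20 <= lam [:: x].
Proof.
have : \sum_(y in [set~ x]) 9 <= \sum_(y in [set~ x]) lam [:: x; y].
  by apply: leq_sum => y; apply: lam2_ge9_setC1.
by rewrite sum_nat_const cardC1_12 sum_lam2; lia.
Qed.

(** Twelve points of degree at least 20 exhaust the [6 * 40] available incidences. *)
Lemma lam1 x : lam [:: x] = 20.
Proof.
have := sum_ge1 (A := setT) (fun y _ => lam1_ge20 y) (in_setT x).
rewrite (cnt_sum_const (k := 6)) => [|b Bb _]; last by rewrite setIT block6.
rewrite cardsT cardX.
have := lam1_ge20 x.
have : lam [::] <= #|B| by apply: subset_leq_card; apply/subsetP => b; rewrite inE => /andP[].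
by move: le40; set m := #|B|; lia.
Qed.

(** The default [x] is never taken: [partnerP] finds exactly one point that qualifies. *)
Definition partner x := odflt x [pick y in [set~ x] | lam [:: x; y] == 10].

(** The eleven counts are at least 9 and sum to [5 * 20 = 99 + 1], so a single one exceeds 9, by
    1. *)
Lemma partnerP x : partner x != x /\ forall y, y != x -> lam [:: x; y] = 9 + (y == partner x).
Proof.
have s := sum_lam2 x; rewrite lam1 in s.
have [y0 Cy0 m] : exists2 y, y \in [set~ x] & 10 <= lam [:: x; y].
  apply/exists_inP; apply: contraT; rewrite negb_exists_in => /forall_inP n.
  have : \sum_(y in [set~ x]) lam [:: x; y] <= \sum_(y in [set~ x]) 9.
    by apply: leq_sum => y /n; rewrite -ltnNge ltnS.
  by rewrite s sum_nat_const cardC1_12.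
have m10 : lam [:: x; y0] = 10.
  have := sum_ge1 (@lam2_ge9_setC1 x) Cy0; rewrite cardC1_12 s; lia.
have other y : y \in [set~ x] -> y != y0 -> lam [:: x; y] = 9.
  move=> Cy yy0; have := lam2_ge9_setC1 Cy.
  have := sum_ge2 (@lam2_ge9_setC1 x) Cy Cy0 yy0; rewrite cardC1_12 s m10; lia.
have -> : partner x = y0.
  rewrite /partner; case: pickP => [y /andP[Cy /eqP E]|/(_ y0)]; last by rewrite Cy0 m10.
  by apply/eqP; apply: contraT => /(other _ Cy); rewrite E.
split=> [|y yx]; first by rewrite !inE in Cy0.
by case: eqVneq => [->|/other->//]; rewrite ?m10 // !inE.
Qed.

Lemma partner_neq x : partner x != x. Proof. by case: (partnerP x). Qed.

Lemma lam2_partner x : lam [:: x; partner x] = 10.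
Proof. by case: (partnerP x) => n /(_ _ n); rewrite eqxx. Qed.

Lemma partnerK : involutive partner.
Proof.
move=> x; have [_ /(_ x)] := partnerP (partner x); rewrite eq_sym partner_neq lam_swap lam2_partner => /(_ isT).
by case: eqVneq.
Qed.

Definition nonpartner x y := (x != y) && (y != partner x).

Lemma nonpartner_sym x y : nonpartner x y = nonpartner y x.
Proof. by rewrite /nonpartner eq_sym; congr (_ && ~~ _); rewrite eq_sym (can2_eq partnerK partnerK). Qed.

Lemma nonpartner_neq x y : nonpartner x y -> x != y. Proof. by case/andP. Qed.

Lemma lam2_nonpartner x y : nonpartner x y -> lam [:: x; y] = 9.
Proof.
case/andP=> xy yp; have [_ ->] := partnerP x; by [rewrite (negPf yp)|rewrite eq_sym].
Qed.

Lemma nonpartner_link x y : nonpartner x y -> #|link x y| = 9.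
Proof. by move=> n; rewrite card_link lam2_nonpartner. Qed.

(** A point has only one partner. Every triple of distinct points thus contains a pair at [x] whose
    link has nine blocks. *)
Lemma nonpartner_or x y z : y != z -> x != y -> x != z -> nonpartner x y || nonpartner x z.
Proof.
move=> yz xy xz; rewrite /nonpartner xy xz /= -negb_and; apply/negP => /andP[/eqP yp /eqP zp].
by rewrite yp zp eqxx in yz.
Qed.

(** * Blocks through three points *)

Lemma lam3_nonpartner_le4 x y z : nonpartner x y -> z != x -> z != y -> lam [:: x; y; z] <= 4.
Proof.
move=> n zx zy; have xy := nonpartner_neq n; rewrite -cnt_link.
by apply: (deg_le4 (cardY xy) (link_block4 xy) (link_cover xy) (nonpartner_link n)); rewrite inY zx.
Qed.

Lemma lam3_le4 x y z : uniq [:: x; y; z] -> lam [:: x; y; z] <= 4.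
Proof.
rewrite /= !inE negb_or andbT => /andP[/andP[xy xz] yz].
have [n|n] := orP (nonpartner_or yz xy xz).
  by apply: lam3_nonpartner_le4; rewrite // eq_sym.
by rewrite lam_swap23; apply: lam3_nonpartner_le4; rewrite // eq_sym.
Qed.

(** Ten values of at most 4 sum to [4 * lam [:: x; partner x] = 40]. *)
Lemma lam3_partner x z : z != x -> z != partner x -> lam [:: x; partner x; z] = 4.
Proof.
move=> zx zp; have xp : x != partner x by rewrite eq_sym partner_neq.
have le4 w : w \in ~: [set x; partner x] -> lam [:: x; partner x; w] <= 4.
  rewrite inY => /andP[wx wp]; apply: lam3_le4.
  by rewrite /= !inE negb_or xp ![_ == w]eq_sym wx wp.
have : \sum_(w in ~: [set x; partner x]) (4 - lam [:: x; partner x; w]) == 0.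
  by rewrite sumnB // sum_nat_const cardY // sum_lam3 // lam2_partner.
have Yz : z \in ~: [set x; partner x] by rewrite inY zx.
rewrite sum_nat_eq0 => /forall_inP/(_ _ Yz); rewrite subn_eq0 => ge4.
by apply/eqP; rewrite eqn_leq ge4 le4.
Qed.

(** In a link of type A this condition, symmetric in the three points, selects the K4 within [D] and
    leaves out the triple edge. Simple triples turn out to be the triples inside hexads. *)
Definition simple x y z := [&& uniq [:: x; y; z], lam [:: x; y; z] == 4 &
  [forall w, (w \notin [:: x; y; z]) ==> (lam [:: x; y; z; w] <= 2)]].

Lemma simple_rot x y z : simple x y z = simple y z x.
Proof.
rewrite /simple -(rot_uniq 1) lam_rot3; congr [&& _, _ & _].
by apply: eq_forallb => w; rewrite lam_rot3 !inE orbC -orbA orbCA.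
Qed.

Lemma simple_swap x y z : simple x y z = simple y x z.
Proof.
rewrite /simple lam_swap; congr [&& _, _ & _].
  by rewrite /= !inE !negb_or !andbT eq_sym; do ![case: (_ == _)].
by apply: eq_forallb => w; rewrite lam_swap !inE orbCA.
Qed.

Lemma simple_neq x y z : simple x y z -> [/\ x != y, x != z & y != z].
Proof. by case/andP; rewrite /= !inE negb_or andbT => /andP[/andP[-> ->] ->]. Qed.

Lemma simpleP x y z w : simple x y z -> w != x -> w != y -> w != z -> lam [:: x; y; z; w] <= 2.
Proof.
move=> /and3P[_ _ /forallP/(_ w)] + wx wy wz; by rewrite !inE !negb_or wx wy wz.
Qed.

Lemma simple_lam3 x y z : simple x y z -> lam [:: x; y; z] = 4.
Proof. by case/and3P=> _ /eqP. Qed.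

(** * Links of type A and their hexads *)

Local Notation low x y := [set z in ~: [set x; y] | cnt (link x y) [:: z] == 3].
Local Notation high x y := [set z in ~: [set x; y] | cnt (link x y) [:: z] != 3].

Lemma in_low x y z : (z \in low x y) = [&& z != x, z != y & lam [:: x; y; z] == 3].
Proof. by rewrite in_set inY cnt_link andbA. Qed.

Lemma in_high x y z : nonpartner x y ->
  (z \in high x y) = [&& z != x, z != y & lam [:: x; y; z] == 4].
Proof.
move=> n; rewrite in_set inY cnt_link -andbA; case: eqVneq => //= zx; case: eqVneq => //= zy.
have := lam3_ge3 (nonpartner_neq n) zx zy; have := lam3_nonpartner_le4 n zx zy.
by case: (lam _) => [|[|[|[|[]]]]].
Qed.

Definition typeA x y := nonpartner x y && [exists b in link x y, low x y \subset b].

Lemma typeA_np x y : typeA x y -> nonpartner x y. Proof. by case/andP. Qed.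

(** In type B, [typeB_mu3] gives every point [z] of [D] a further point with count at least 3. *)
Lemma simple_typeA x y z : nonpartner x y -> simple x y z -> typeA x y.
Proof.
move=> n s; have xy := nonpartner_neq n; rewrite /typeA n; apply: contraT.
rewrite negb_exists_in => /forall_inP noL.
have [_ xz yz] := simple_neq s; rewrite eq_sym in xz; rewrite eq_sym in yz.
have Hz : z \in high x y by rewrite in_high // xz yz simple_lam3.
have [w []] := typeB_mu3 (cardY xy) (link_block4 xy) (link_cover xy) (nonpartner_link n) noL Hz.
rewrite inY cnt_link => /andP[wx wy] wz; have := simpleP s wx wy wz.
by case: (lam _) => [|[|[]]].
Qed.

Definition hexad x y := x |: (y |: [set z | simple x y z]).

Lemma in_hexad x y z : (z \in hexad x y) = [|| z == x, z == y | simple x y z].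
Proof. by rewrite !inE. Qed.

(** This is [typeA_struct] in terms of [lam]. The set [K] there consists of the [z] with
    [simple x y z]: its points have only counts 1 and 2, while [u] and [w] have count 4 together. *)
Lemma typeA_hexad x y : typeA x y -> exists u w,
  [/\ u != w, u \notin hexad x y, w \notin hexad x y & #|hexad x y| = 6] /\
  [/\ forall a b, simple x y a -> simple x y b -> a != b -> lam [:: x; y; a; b] = 2,
      forall a b, simple x y a -> b \notin hexad x y -> lam [:: x; y; a; b] = 1,
      lam [:: x; y; u; w] = 4 &
      forall z, z \notin hexad x y -> z != u -> z != w -> lam [:: x; y; z] = 3].
Proof.
move=> /andP[n /exists_inP[c Fc Lc]]; have xy := nonpartner_neq n.
have [K [u [w [KD cK E uw [KK KC m4]]]]] :=
  typeA_struct (cardY xy) (link_block4 xy) (link_cover xy) (nonpartner_link n) Fc Lc.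
have : u \in high x y :\: K by rewrite E !inE eqxx.
have : w \in high x y :\: K by rewrite E !inE eqxx orbT.
rewrite in_setD in_high // => /and4P[nKw wx wy /eqP w4].
rewrite in_setD in_high // => /and4P[nKu ux uy /eqP u4].
rewrite cnt_link in m4.
have Y1 z : z \in K -> [/\ z != x, z != y & lam [:: x; y; z] = 4].
  by move=> /(subsetP KD); rewrite in_high // => /and3P[-> -> /eqP].
have simK z : simple x y z = (z \in K).
  apply/idP/idP => [s|Kz].
    have [_ xz yz] := simple_neq s; rewrite eq_sym in xz; rewrite eq_sym in yz.
    have : z \in high x y by rewrite in_high // xz yz simple_lam3.
    apply: contraTT => nKz; apply/negP => Hz.
    have : z \in high x y :\: K by rewrite inE nKz.
    rewrite E !inE => /orP[] /eqP Ez; rewrite {}Ez in s *.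
      have := simpleP s wx wy; rewrite eq_sym uw m4 => /(_ isT) //.
    by have := simpleP s ux uy uw; rewrite lam_swap34 m4.
  have [zx zy z4] := Y1 z Kz; apply/and3P; split.
  - by rewrite /= !inE negb_or xy ![_ == z]eq_sym zx zy.
  - by rewrite z4.
  apply/forallP => v; apply/implyP; rewrite !inE !negb_or => /and3P[vx vy vz].
  rewrite -cnt_link; case Kv : (v \in K).
    by rewrite (KK z v) // eq_sym.
  by rewrite (KC z v) // inE Kv inY vx.
have nSS z : z \notin hexad x y -> [/\ z != x, z != y & z \notin K].
  by rewrite in_hexad !negb_or simK => /and3P[].
exists u, w; split; split=> //; rewrite ?in_hexad ?simK ?negb_or ?ux ?uy ?wx ?wy //.
- have -> : hexad x y = x |: (y |: K) by apply/setP => z; rewrite in_hexad !in_setU1 simK.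
  have nKx : x \notin K by apply/negP => /Y1[]; rewrite eqxx.
  have nKy : y \notin K by apply/negP => /Y1[_]; rewrite eqxx.
  by rewrite !cardsU1 cK !inE negb_or xy nKx nKy.
- by move=> a b; rewrite !simK -cnt_link => Ka Kb; apply: KK.
- move=> a b; rewrite simK -cnt_link => Ka /nSS[bx b_y nKb]; apply: KC => //.
  by rewrite inE nKb inY bx.
move=> z /nSS[zx zy nKz] zu zw.
have : z \notin high x y.
  apply/negP => Hz; have : z \in high x y :\: K by rewrite inE nKz.
  by rewrite E !inE (negPf zu) (negPf zw).
rewrite in_set inY zx zy cnt_link /= negbK => /eqP //.
Qed.

Lemma simple_swap23 x y z : simple x y z = simple x z y.
Proof. by rewrite simple_swap simple_rot. Qed.

Lemma typeA_sym x y : typeA x y = typeA y x.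
Proof.
have E : link x y = link y x by apply/setP => b; rewrite !inE; congr (_ && _); apply: andbC.
by rewrite /typeA nonpartner_sym E setUC.
Qed.

Lemma hexad_sym x y : hexad x y = hexad y x.
Proof. by apply/setP => z; rewrite !in_hexad simple_swap orbCA. Qed.

Lemma card_hexad x y : typeA x y -> #|hexad x y| = 6.
Proof. by case/typeA_hexad => u [w [[]]]. Qed.

(** A point [t] of the hexad of [x], [y] outside that of [x], [z] would have count 1 with [x], [z],
    [y], but seen from [x], [y] this count is 2. Equal sizes do the rest. *)
Lemma hexad_step x y z : typeA x y -> simple x y z -> nonpartner x z ->
  typeA x z /\ hexad x z = hexad x y.
Proof.
move=> Axy s n; have s' : simple x z y by rewrite -simple_swap23.
have Axz := simple_typeA n s'; split=> //; apply/eqP; rewrite eq_sym eqEcard !card_hexad // leqnn andbT.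
have [? [? [_ [m2 _ _ _]]]] := typeA_hexad Axy; have [? [? [_ [_ m1 _ _]]]] := typeA_hexad Axz.
apply/subsetP => t; rewrite in_hexad => /or3P[/eqP->|/eqP->|st].
- by rewrite in_hexad eqxx.
- by rewrite in_hexad s' !orbT.
case: (eqVneq z t) => [<-|zt]; first by rewrite in_hexad eqxx orbT.
apply: contraT => /(m1 _ _ s'); by rewrite lam_swap23 m2.
Qed.

Lemma hexad_pair x y p : typeA x y -> p \in hexad x y -> nonpartner x p ->
  typeA x p /\ hexad x p = hexad x y.
Proof.
move=> Axy; rewrite in_hexad => /or3P[/eqP->|/eqP-> _|]; [by rewrite /nonpartner eqxx|by []|exact: hexad_step].
Qed.

(** * Hexads as sets, freed from the generating pair *)

Definition hexads := [set S | [exists x, exists y, typeA x y && (S == hexad x y)]].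

Lemma hexadsP S : reflect (exists x y, typeA x y /\ S = hexad x y) (S \in hexads).
Proof.
rewrite inE; apply: (iffP existsP) => [[x /existsP[y /andP[A /eqP E]]]|[x [y [A E]]]].
  by exists x, y.
by exists x; apply/existsP; exists y; rewrite A E eqxx.
Qed.

(** The generators are replaced one at a time: first by [q] and one of [x], [y] that is not its
    partner, then by [q] and [p]. *)
Lemma hexads_pair S p q : S \in hexads -> p \in S -> q \in S -> nonpartner p q ->
  typeA p q /\ hexad p q = S.
Proof.
move=> /hexadsP[x [y [A ->]]] Sp Sq n.
have [r [Ar Er]] : exists r, typeA q r /\ hexad q r = hexad x y.
  case: (eqVneq q x) => [->|qx]; first by exists y.
  case: (eqVneq q y) => [->|qy]; first by exists x; rewrite typeA_sym hexad_sym.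
  have [nx|ny] := orP (nonpartner_or (nonpartner_neq (typeA_np A)) qx qy).
    by exists x; rewrite typeA_sym hexad_sym; apply: hexad_pair => //; rewrite nonpartner_sym.
  exists y; rewrite typeA_sym (hexad_sym q) (hexad_sym x); apply: hexad_pair; last by rewrite nonpartner_sym.
    by rewrite typeA_sym.
  by rewrite hexad_sym.
by rewrite typeA_sym hexad_sym -Er; apply: hexad_pair; rewrite ?Er // nonpartner_sym.
Qed.

Lemma hexads_card S : S \in hexads -> #|S| = 6.
Proof. by case/hexadsP => x [y [A ->]]; apply: card_hexad. Qed.

Lemma hexads_eq S T p q : S \in hexads -> T \in hexads ->
  p \in S -> q \in S -> p \in T -> q \in T ->
  nonpartner p q -> S = T.
Proof.
move=> FS FT Sp Sq Tp Tq n.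
by have [_ <-] := hexads_pair FS Sp Sq n; have [_ <-] := hexads_pair FT Tp Tq n.
Qed.

Lemma uniq3 (x y z : X) : uniq [:: x; y; z] = [&& x != y, x != z & y != z].
Proof. by rewrite /= !inE negb_or andbT andbA. Qed.

Lemma hexads_simple S x y z : S \in hexads -> x \in S -> y \in S -> z \in S ->
  uniq [:: x; y; z] -> simple x y z.
Proof.
move=> FS Sx Sy Sz; rewrite uniq3 => /and3P[xy xz yz].
have [n|n] := orP (nonpartner_or yz xy xz).
  have [_ E] := hexads_pair FS Sx Sy n; move: Sz.
  by rewrite -E in_hexad ![z == _]eq_sym (negPf xz) (negPf yz).
have [_ E] := hexads_pair FS Sx Sz n; move: Sy.
by rewrite -E in_hexad simple_swap23 (negPf yz) eq_sym (negPf xy).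
Qed.

Lemma simple_hexads x y z : simple x y z ->
  exists2 S, S \in hexads & [/\ x \in S, y \in S & z \in S].
Proof.
move=> s; have [xy xz yz] := simple_neq s; have [n|n] := orP (nonpartner_or yz xy xz).
  exists (hexad x y); first by apply/hexadsP; exists x, y; split; rewrite // (simple_typeA n s).
  by rewrite !in_hexad !eqxx s !orbT.
rewrite simple_swap23 in s; exists (hexad x z).
  by apply/hexadsP; exists x, z; split; rewrite // (simple_typeA n s).
by rewrite !in_hexad !eqxx s !orbT.
Qed.

(** * The number of hexads *)

Lemma hexads_through_pair x y : nonpartner x y -> cnt hexads [:: y; x] <= 1.
Proof.
move=> n; rewrite leqNgt; apply/negP => /card_gt1P[S [T []]].
rewrite !in_set /= -!(in_set (fun S => [exists x, exists y, typeA x y && (S == hexad x y)])).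
move=> /and4P[FS Sy Sx _] /and4P[FT Ty Tx _] /negP[]; apply/eqP; exact: hexads_eq n.
Qed.

(** Each hexad through [x] has at least four of the ten points other than [x] and its partner, and
    no such point is in two of these hexads. *)
Lemma hexads_through_le2 x : cnt hexads [:: x] <= 2.
Proof.
have xp : x != partner x by rewrite eq_sym partner_neq.
have : \sum_(y in ~: [set x; partner x]) cnt hexads [:: y; x] <= 1 * 10.
  rewrite -(cardY xp) mul1n -sum1_card; apply: leq_sum => y; rewrite inY => /andP[yx yp].
  by apply: hexads_through_pair; rewrite /nonpartner eq_sym yx.
rewrite cnt_sum => le.
have : \sum_(S in hexads | all (mem S) [:: x]) 4 <= 10.
  apply: leq_trans le; apply: leq_sum => S /andP[FS _].
  rewrite -setDE cardsD (hexads_card FS).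
  have : #|S :&: [set x; partner x]| <= #|[set x; partner x]| by apply: subset_leq_card; apply: subsetIr.
  by rewrite cards2 xp; lia.
rewrite sum_nat_const; have -> : #|[pred S in hexads | all (mem S) [:: x]]| = cnt hexads [:: x].
  by apply: eq_card => S; rewrite !inE.
by move: (cnt hexads [:: x]) => m; clear; lia.
Qed.

(** The sum is at most 1: a triple contains a nonpartner pair, hence lies in at most one hexad. *)
Lemma simple_count x y z : simple x y z =
  \sum_(S in hexads | all (mem S) [:: x]) [&& uniq [:: x; y; z], y \in S & z \in S] :> nat.
Proof.
case s : (simple x y z).
  have [S FS [Sx Sy Sz]] := simple_hexads s; have [xy xz yz] := simple_neq s.
  rewrite (bigD1 S) ?FS /= ?Sx // big1 => [|T]; first by rewrite Sy Sz !inE negb_or xy xz yz.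
  rewrite andbT => /andP[/andP[FT Tx] TS]; apply/eqP; rewrite eqb0; apply: contra TS.
  move=> /and3P[_ Ty Tz]; apply/eqP; have [n|n] := orP (nonpartner_or yz xy xz).
    exact: hexads_eq n.
  exact: hexads_eq n.
rewrite big1 // => S /= /andP[FS /andP[Sx _]]; apply/eqP; rewrite eqb0; apply/negP => /and3P[u Sy Sz].
by rewrite (hexads_simple FS) in s.
Qed.

Lemma sum_bool_card (P : pred X) : \sum_y P y = #|[set y | P y]|.
Proof. by rewrite -big_mkcond sum1dep_card. Qed.

Lemma sum_simple x : \sum_y \sum_z simple x y z = 20 * cnt hexads [:: x].
Proof.
under eq_bigr => y _ do under eq_bigr => z _ do rewrite simple_count.
under eq_bigr => y _ do rewrite exchange_big /=.
rewrite exchange_big /= (eq_bigr (fun=> 20)) => [|S /andP[FS /andP[Sx _]]].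
  rewrite sum_nat_const mulnC; congr (_ * _).
  by apply: eq_card => S; rewrite [RHS]in_set.
rewrite (bigID [in S :\ x]) /= [X in _ + X]big1 ?addn0 => [|y]; last first.
  move=> nS; rewrite big1 // => z _; apply/eqP; rewrite eqb0; apply: contra nS.
  by rewrite !inE negb_or => /and3P[/andP[/andP[xy _] _] Sy _]; rewrite eq_sym xy.
have c5 : #|S :\ x| = 5 by have := hexads_card FS; rewrite (cardsD1 x) Sx => -[].
rewrite (eq_bigr (fun=> 4)) ?sum_nat_const ?c5 // => y Sy.
rewrite sum_bool_card; have := c5; rewrite (cardsD1 y) Sy => -[<-].
apply: eq_card => z; move: Sy; rewrite !inE negb_or => /andP[yx ->].
by rewrite ![_ == z]eq_sym [x == y]eq_sym yx /=; do ![case: (_ == _)].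
Qed.

Lemma count_lam4 x : \sum_y \sum_z (uniq [:: x; y; z] && (lam [:: x; y; z] == 4)) = 70.
Proof.
(* Each of the ten nonpartners [y] contributes the six points of [D], and the partner all ten
   points, that is, six plus four. *)
have -> : 70 = \sum_y (6 * (y \in [set~ x]) + 4 * (y == partner x)).
  rewrite big_split /= -!big_distrr /= sum_bool_card.
  rewrite (eq_card (B := [set~ x])) => [|y]; last by rewrite !inE.
  rewrite cardC1_12 sum_bool_card (eq_card (B := [set partner x])) => [|y]; last by rewrite !inE.
  by rewrite cards1.
apply: eq_bigr => y _; rewrite !inE; case: (eqVneq y x) => [->|yx].
  by rewrite eq_sym (negPf (partner_neq x)) big1 // => z _; rewrite uniq3 eqxx.
rewrite sum_bool_card; case: (eqVneq y (partner x)) => [->|yp].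
  have xp : x != partner x by rewrite eq_sym partner_neq.
  rewrite -[RHS]/10 -(cardY xp); apply: eq_card => z; rewrite inY inE uniq3 xp ![_ == z]eq_sym /=.
  by case: eqVneq => //= zx; case: eqVneq => //= zp; rewrite lam3_partner.
have n : nonpartner x y by rewrite /nonpartner eq_sym yx.
have xy := nonpartner_neq n.
rewrite -[RHS]/6 -[RHS](card_D (cardY xy) (link_block4 xy) (link_cover xy) (nonpartner_link n)).
by apply: eq_card => z; rewrite in_high // inE uniq3 xy ![_ == z]eq_sym /= -andbA.
Qed.

(** If [lam [:: x; y; z] = 4], the nine further counts are positive with sum 12, so at most one
    reaches 3; if it is 3, they all equal 1. The sum over [w] thus detects the triples of count 4
    that are not simple. *)
Lemma excess_split x y z : uniq [:: x; y; z] && (lam [:: x; y; z] == 4) =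
  simple x y z + \sum_w (uniq [:: x; y; z; w] && (3 <= lam [:: x; y; z; w])) :> nat.
Proof.
have uw w : uniq [:: x; y; z; w] = (w \notin [:: x; y; z]) && uniq [:: x; y; z].
  exact: rcons_uniq [:: x; y; z] w.
rewrite /simple sum_bool_card; case u : (uniq [:: x; y; z]); last first.
  rewrite add0n; apply/esym/eqP; rewrite cards_eq0 -subset0; apply/subsetP => w.
  by rewrite inE uw u andbF.
have := u; rewrite uniq3 => /and3P[xy xz yz].
have Yz : z \in ~: [set x; y] by rewrite inY ![z == _]eq_sym xz.
have Yw w : w \notin [:: x; y; z] -> (w \in ~: [set x; y]) /\ z != w.
  by rewrite [z == w]eq_sym !inE !negb_or => /and3P[-> -> ->].
have z3 := lam3_ge3 xy; rewrite eq_sym in xz; rewrite eq_sym in yz.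
have {}z3 := z3 z xz yz; have z4 := lam3_le4 u.
set A := [set w | _]; case E : (lam [:: x; y; z] == 4) => /=; last first.
  rewrite add0n; apply/esym/eqP; rewrite cards_eq0 -subset0; apply/subsetP => w.
  rewrite inE uw u andbT => /andP[/Yw[Y_w zw] w3].
  have := lam4_bound xy Yz Y_w zw; move/eqP: E z3 z4 w3.
  by move: (lam _) (lam _) => a b; clear; lia.
case: (boolP [forall w, _]) => [/forallP all2|].
  rewrite -[LHS](addn0 1); congr (_ + _); apply/esym/eqP; rewrite cards_eq0 -subset0; apply/subsetP => w.
  by rewrite inE uw u andbT => /andP[nw]; have := all2 w; rewrite nw leqNgt => /negPf ->.
rewrite negb_forall => /existsP[w]; rewrite negb_imply -ltnNge => /andP[nw w3].
rewrite -(cards1 w) add0n; apply/eq_card => v; rewrite !inE uw u andbT.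
case: (eqVneq v w) => [->|vw]; first by rewrite nw w3.
apply/esym/negbTE/negP => /andP[nv v3]; have [Y_w zw] := Yw _ nw; have [Yv zv] := Yw _ nv.
rewrite eq_sym in vw; have := lam4_bound2 xy Yz Y_w Yv zw zv vw; rewrite (eqP E).
by move: w3 v3; move: (lam _) (lam _) => a b; clear; lia.
Qed.

(* The 70 ordered pairs (y, z) with lam x y z = 4 split into 20 for each hexad
   through [x] and a number divisible by 3. *)
Lemma card_hexads_through x : cnt hexads [:: x] = 2.
Proof.
have := count_lam4 x; under eq_bigr => y _ do under eq_bigr => z _ do rewrite excess_split.
under eq_bigr => y _ do rewrite big_split /=.
rewrite big_split /= sum_simple.
have /dvdnP[k ->] : 3 %| \sum_y \sum_z \sum_w (uniq [:: x; y; z; w] && (3 <= lam [:: x; y; z; w])).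
  apply: dvdn3_sum_cyclic => y z w.
    have p : perm_eq [:: x; y; z; w] [:: x; z; w; y] by apply/permP => q /=; lia.
    by rewrite (perm_uniq p) (cnt_perm _ p).
  by move=> nu; rewrite [uniq (x :: _)]cons_uniq (negPf nu) andbF.
(* From [70 = 20 * c + k * 3], [c] is 2 modulo 3, and [c <= 2]. *)
by have := hexads_through_le2 x; move: (cnt hexads [:: x]) => c; clear; lia.
Qed.

Lemma card_hexads : #|hexads| = 4.
Proof.
have : \sum_(x in [set: X]) cnt hexads [:: x] = 6 * cnt hexads [::].
  by apply: cnt_sum_const => S FS _; rewrite setIT hexads_card.
have -> : cnt hexads [::] = #|hexads| by apply: eq_card => S; rewrite in_set andbT.
rewrite (eq_bigr (fun=> 2)) => [|x _]; last exact: card_hexads_through.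
by rewrite sum_nat_const cardsT cardX; move: #|hexads| => m; clear; lia.
Qed.

(** * Intersections of hexads *)

Lemma hexads_inter S T x y : S \in hexads -> T \in hexads -> S != T -> x \in S -> x \in T ->
  y \in S -> y \in T -> y \in [set x; partner x].
Proof.
move=> FS FT ST Sx Tx Sy Ty; apply: contraR ST => yx; apply/eqP.
apply: (hexads_eq (p := x) (q := y)) => //.
by move: yx; rewrite !inE negb_or eq_sym.
Qed.

Lemma hexads_inter_le2 S T : S \in hexads -> T \in hexads -> S != T -> #|S :&: T| <= 2.
Proof.
move=> FS FT ST; have [->|/set0Pn[x /setIP[Sx Tx]]] := eqVneq (S :&: T) set0; first by rewrite cards0.
apply: leq_trans (_ : #|[set x; partner x]| <= 2); last by rewrite cards2; case: (_ != _).
apply: subset_leq_card; apply/subsetP => y /setIP[Sy Ty]; exact: hexads_inter ST Sx Tx Sy Ty.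
Qed.

(** The six points of [S] lie in two hexads each. Apart from [S] itself this leaves 6 incidences for
    three hexads taking at most 2 each. *)
Lemma hexads_inter2 S T : S \in hexads -> T \in hexads -> S != T -> #|S :&: T| = 2.
Proof.
move=> FS FT ST.
have : \sum_(U in hexads) #|U :&: S| = 12.
  rewrite -[12]/(6 * 2) -(hexads_card FS) -sum_nat_const -(eq_bigr _ (fun z _ => card_hexads_through z)).
  by rewrite cnt_sum; apply: eq_bigl => U; rewrite andbT.
rewrite (big_setD1 S) //= setIid hexads_card // => s.
have c3 : #|hexads :\ S| = 3 by have := card_hexads; rewrite (cardsD1 S) FS => -[].
have le2 U : U \in hexads :\ S -> #|U :&: S| <= 2.
  by case/setD1P=> US FU; apply: hexads_inter_le2.
have : \sum_(U in hexads :\ S) (2 - #|U :&: S|) == 0.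
  by rewrite sumnB // sum_nat_const c3; move: s; move: (\sum_(U in _) _) => m; clear; lia.
have FT' : T \in hexads :\ S by rewrite in_setD1 eq_sym ST.
rewrite sum_nat_eq0 => /forall_inP/(_ _ FT'); rewrite subn_eq0 setIC => ge2.
by apply/eqP; rewrite eqn_leq ge2 andbT setIC le2.
Qed.

Lemma hexads_other S x : S \in hexads -> x \in S -> exists T, [/\ T \in hexads, T != S & x \in T].
Proof.
move=> FS Sx; have : 1 < cnt hexads [:: x] by rewrite card_hexads_through.
case/card_gt1P => T [U []]; rewrite [T \in _]in_set [U \in _]in_set /=.
move=> /and3P[FT Tx _] /and3P[FU Ux _] TU; case: (eqVneq T S) => [E|TS]; last by exists T.
by exists U; rewrite -E eq_sym.
Qed.

(** Another hexad through [x] shares two points with [S], and by [hexads_inter] the second can only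
    be the partner. *)
Lemma hexads_partner S x : S \in hexads -> x \in S -> partner x \in S.
Proof.
move=> FS Sx; have [T [FT TS Tx]] := hexads_other FS Sx.
have := hexads_inter2 FT FS TS; rewrite (cardsD1 x) inE Tx Sx => -[/eqP/cards1P[y E]].
have : y \in (T :&: S) :\ x by rewrite E inE.
case/setD1P => yx /setIP[Ty Sy]; have := hexads_inter FT FS TS Tx Sx Ty Sy.
by rewrite !inE (negPf yx) => /eqP <-.
Qed.

Lemma hexads_lam4 S x y z w : S \in hexads -> x \in S -> y \in S -> z \in S ->
  uniq [:: x; y; z] -> w \notin S -> lam [:: x; y; z; w] = 1.
Proof.
move=> FS Sx Sy Sz u nw; have := u; rewrite uniq3 => /and3P[xy xz yz].
have m1 a b c : typeA a b -> hexad a b = S -> simple a b c -> lam [:: a; b; c; w] = 1.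
  by move=> A E s; have [? [? [_ [_ -> //]]]] := typeA_hexad A; rewrite E.
have s := hexads_simple FS Sx Sy Sz u; have [n|n] := orP (nonpartner_or yz xy xz).
  by have [A E] := hexads_pair FS Sx Sy n; apply: m1.
rewrite lam_swap23; have [A E] := hexads_pair FS Sx Sz n; apply: m1 => //.
by rewrite -simple_swap23.
Qed.

(** * Triple edges and the contradiction *)

Lemma lam4_pair_le5 x y z a b : uniq [:: x; y; z; a; b] ->
  lam [:: x; y; z; a] + lam [:: x; y; z; b] <= 5.
Proof.
rewrite /= !inE !negb_or andbT => /and4P[/and4P[xy xz xa xb] /and3P[yz ya yb] /andP[za zb] ab].
have Y v : x != v -> y != v -> v \in ~: [set x; y] by rewrite inY ![v == _]eq_sym => -> ->.
have := lam4_bound2 xy (Y _ xz yz) (Y _ xa ya) (Y _ xb yb) za zb ab.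
have := @lam3_le4 x y z; rewrite uniq3 xy xz yz => /(_ isT).
by move: (lam _) (lam _) (lam _) => p q r; clear; lia.
Qed.

(** There remain [12 - (6 + 6 - 2)] points, and hexads are closed under [partner], hence so is the
    complement. *)
Lemma hexads_compl S T u : S \in hexads -> T \in hexads -> S != T -> u \notin S -> u \notin T ->
  ~: (S :|: T) = [set u; partner u].
Proof.
move=> FS FT ST nSu nTu.
have nS U : U \in hexads -> u \notin U -> partner u \notin U.
  by move=> FU; apply: contra => /(hexads_partner FU); rewrite partnerK.
apply/esym/eqP; rewrite eqEcard; apply/andP; split.
  by rewrite subUset !sub1set !inE !negb_or nSu nTu !nS.
have up : u != partner u by rewrite eq_sym partner_neq.
rewrite cards2 up cardsCs setCK cardX; have := cardsUI S T; rewrite hexads_inter2 // (hexads_card FS) (hexads_card FT).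
by move: #|S :|: T| => m; clear; lia.
Qed.

(** [u] and [w] span the triple edge in the link of [x] and [y], and exactly one of them must lie in
    [T]. If both did, [x], [u], [w] would be simple, against their count 4 with [y]. *)
Lemma hexads_excess S T x y : S \in hexads -> T \in hexads -> S != T -> x \in S -> x \in T ->
  y \in S -> nonpartner x y -> exists u w, [/\ u \notin S, u \notin T, w \notin S & w \in T] /\
    lam [:: x; y; u; w] = 4 /\ forall z, z \notin S -> z != u -> z != w -> lam [:: x; y; z] = 3.
Proof.
move=> FS FT ST Sx Tx Sy n; have [A E] := hexads_pair FS Sx Sy n.
have [u [w []]] := typeA_hexad A; rewrite E => -[uw nSu nSw _] [_ _ m4 low3].
have neqS a b : a \in S -> b \notin S -> a != b by move=> Sa; apply: contraNneq => <-.
have neqT a b : a \in T -> b \notin T -> a != b by move=> Ta; apply: contraNneq => <-.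
have [[[xu xw] yu] yw] := (neqS _ _ Sx nSu, neqS _ _ Sx nSw, neqS _ _ Sy nSu, neqS _ _ Sy nSw).
have perm_m4 : lam [:: x; u; w; y] = 4 by rewrite -lam_rot234.
case Tu : (u \in T); case Tw : (w \in T).
- have s : simple x u w by apply: (hexads_simple FT) => //; rewrite uniq3 xu xw uw.
  have := simpleP s; move/(_ y); rewrite perm_m4 eq_sym (nonpartner_neq n) yu yw.
  by move=> /(_ isT isT isT).
- exists w, u; split; first by rewrite nSw nSu Tw Tu.
  by rewrite lam_swap34; split=> // z nSz zw zu; apply: low3.
- by exists u, w; split; rewrite ?nSw ?nSu ?Tw ?Tu.
(* If neither lies in [T], they are the two points outside both hexads. In the link of [x] and its
   partner, [u] has count 1 with every other point but [w], hence count 4 with [w]. Then [x], [u],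
   [w] have count 4 with both [y] and [partner x], against [lam4_pair_le5]. *)
move/negbT in Tu; move/negbT in Tw; have C := hexads_compl FS FT ST nSu Tu.
have Ew : w = partner u.
  have : w \in [set u; partner u] by rewrite -C !inE negb_or nSw Tw.
  by rewrite !inE eq_sym (negPf uw) => /eqP.
have [Spx Tpx] := (hexads_partner FS Sx, hexads_partner FT Tx).
have xp : x != partner x by rewrite eq_sym partner_neq.
have [pu pw] := (neqS _ _ Spx nSu, neqS _ _ Spx nSw).
have yp : y != partner x by case/andP: n.
have u3 : lam [:: x; partner x; u] = 4 by apply: lam3_partner; rewrite eq_sym.
have Yu : u \in ~: [set x; partner x] by rewrite inY ![u == _]eq_sym xu.
have Yw : w \in (~: [set x; partner x]) :\ u by rewrite in_setD1 inY ![w == _]eq_sym uw xw.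
have := sum_lam4 xp Yu; rewrite u3 (big_setD1 w) //= (eq_bigr (fun=> 1)) => [|v]; last first.
  move=> /setD1P[vw /setD1P[vu]]; rewrite inY => /andP[vx vp]; rewrite lam_swap34.
  have uv : uniq [:: x; partner x; v] by rewrite uniq3 xp ![_ == v]eq_sym vx.
  have : v \notin ~: (S :|: T) by rewrite C -Ew !inE negb_or vu.
  rewrite inE negbK => /setUP[Sv|Tv]; first exact: (hexads_lam4 FS).
  exact: (hexads_lam4 FT).
have c8 : #|(~: [set x; partner x]) :\ u :\ w| = 8.
  have := cardY xp; rewrite (cardsD1 u) Yu => -[]; by rewrite (cardsD1 w) Yw => -[].
rewrite sum1_card c8 -[3 * 4]/(4 + 8) => /addIn w4.
have := @lam4_pair_le5 x u w y (partner x); rewrite perm_m4.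
have -> : lam [:: x; u; w; partner x] = 4 by rewrite -lam_rot234.
rewrite /= !inE !negb_or xu xw (nonpartner_neq n) xp uw [u == y]eq_sym yu [u == _]eq_sym pu.
by rewrite [w == y]eq_sym yw [w == _]eq_sym pw yp => /(_ isT).
Qed.

Lemma typeA_block x y : typeA x y -> exists c, [/\ c \in B, x \in c, y \in c &
  forall z, z != x -> z != y -> (z \in c) = (lam [:: x; y; z] == 3)].
Proof.
move=> /andP[n /exists_inP[c Fc Lc]]; have xy := nonpartner_neq n.
exists c; have := Fc; rewrite inE => /and3P[Bc xc yc]; split=> // z zx zy.
case: eqP => [z3|/eqP z3]; first by apply: (subsetP Lc); rewrite in_low zx zy z3.
apply/negbTE/(typeA_block_disjoint (cardY xy) (link_block4 xy) (link_cover xy) (nonpartner_link n) Fc Lc).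
by rewrite in_set inY zx zy cnt_link.
Qed.

Lemma no_covering40 : False.
Proof.
have /card_gt0P[S FS] : 0 < #|hexads| by rewrite card_hexads.
have /card_gt0P[x Sx] : 0 < #|S| by rewrite hexads_card.
have [T [FT TS Tx]] := hexads_other FS Sx; have ST : S != T by rewrite eq_sym.
have pick_out (U A : {set X}) : #|A| < #|U| -> exists2 y, y \in U & y \notin A.
  move=> lt; have /subsetPn[y] : ~~ (U \subset A); last by exists y.
  by apply: contraL lt => /subset_leq_card; rewrite -leqNgt.
have [|y Sy] := pick_out S [set x; partner x].
  by rewrite (hexads_card FS) cards2; case: (_ != _).
rewrite !inE negb_or => /andP[yx yp].
have nxy : nonpartner x y by rewrite /nonpartner eq_sym yx.
have nTy : y \notin T.
  by apply: contra yp => Ty; have := hexads_inter FS FT ST Sx Tx Sy Ty; rewrite !inE (negPf yx).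
have [u [w [[nSu nTu nSw Tw] [uw4 low_xy]]]] := hexads_excess FS FT ST Sx Tx Sy nxy.
(* Avoiding the partner of [w] too ensures that both [r] and [partner r] differ from [w], so that
   both lie in the block [c] below. *)
have [|r Tr] := pick_out T (w |: (partner w |: [set x; partner x])).
  by rewrite (hexads_card FT) !cardsU1 cards1; do ![case: (_ \in _)].
rewrite !inE !negb_or => /and4P[rw rpw rx rp].
have nxr : nonpartner x r by rewrite /nonpartner eq_sym rx.
have notS z : z \in T -> z != x -> z != partner x -> z \notin S.
  move=> Tz zx zp; apply/negP => Sz; have := hexads_inter FS FT ST Sx Tx Sz Tz.
  by rewrite !inE (negPf zx) (negPf zp).
have neqpr a b : a != partner b -> partner a != b by apply: contraNneq => <-; rewrite partnerK.
have Tr' := hexads_partner FT Tr; have r'x := neqpr _ _ rp; have r'w := neqpr _ _ rpw.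
have r'p : partner r != partner x by rewrite (inj_eq (can_inj partnerK)).
have [nSr nSr'] := (notS _ Tr rx rp, notS _ Tr' r'x r'p).
have nS' U : U \in hexads -> u \notin U -> partner u \notin U.
  by move=> FU; apply: contra => /(hexads_partner FU); rewrite partnerK.
have neqM (U : {set X}) a b : a \in U -> b \notin U -> a != b by move=> Ua; apply: contraNneq => <-.
have neqM' (U : {set X}) a b : a \notin U -> b \in U -> a != b by move=> + Ub; apply: contraNneq => ->.
have [Axy Exy] := hexads_pair FS Sx Sy nxy; have [Axr Exr] := hexads_pair FT Tx Tr nxr.
(* Besides [x] and [y], this block contains every point outside [S] other than [u] and [w]. *)
have [c [Bc xc yc cE]] := typeA_block Axy.
have in_c z : z \notin S -> z != u -> z != w -> z \in c.
  by move=> nSz zu zw; rewrite cE ?low_xy // ?(neqM' _ _ _ nSz).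
have rc : r \in c by apply: in_c => //; apply: neqM nTu.
have r'c : partner r \in c by apply: in_c => //; apply: neqM nTu.
have u'c : partner u \in c.
  by apply: in_c; rewrite ?nS' ?partner_neq //; apply: neqM' Tw; apply: nS'.
have [t [s [[nTt nSt nTs Ss] [ts4 low_xr]]]] := hexads_excess FT FS TS Tx Sx Tr nxr.
have sx : s != x by apply: neqM' nTs Tx.
have ys : y != s.
  apply: contraPneq ts4 => <-; have := low_xy r nSr (neqM _ _ _ Tr nTu) rw => r3.
  have : lam [:: x; r; t; y] <= lam [:: x; y; r].
    by apply: cnt_sub => v; rewrite !inE => /or3P[] ->; rewrite ?orbT.
  by rewrite r3 => le E; rewrite E in le.
have : t \in [set u; partner u] by rewrite -(hexads_compl FS FT ST nSu nTu) !inE negb_or nSt.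
rewrite !inE => /orP[] /eqP Et; rewrite {}Et in nTt nSt ts4 low_xr.
  (* Case [t = u]. The block [d] obtained from [x] and [r] contains [y] and [partner u]. Since [lam
     [:: x; r; y] = 3], only one block contains these four points, so [c = d]. But [partner r] is in
     [c] and, having count 4 with [x] and [r], not in [d]. *)
  have [d [Bd xd rd dE]] := typeA_block Axr.
  have yd : y \in d.
    by rewrite dE ?low_xr // ?(neqM _ _ _ Sy nSr) // (neqM _ _ _ Sy nSu).
  have nTu' := nS' T FT nTu; have nSu' := nS' S FS nSu.
  have u'd : partner u \in d.
    by rewrite dE ?low_xr // ?partner_neq // ?(neqM' _ _ _ nSu' Ss) // (neqM' _ _ _ nTu').
  have : lam [:: x; r; y; partner u] = 1.
    have ry : r != y by apply: neqM' nSr Sy.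
    have Yy : y \in ~: [set x; r] by rewrite inY yx eq_sym.
    have Yu' : partner u \in ~: [set x; r] by rewrite inY !(neqM' _ _ _ nTu').
    have yu' : y != partner u by apply: neqM nSu'.
    have := lam4_bound (nonpartner_neq nxr) Yy Yu' yu'; rewrite low_xr ?(neqM _ _ _ Sy nSu) //.
    have : 0 < lam [:: x; r; y; partner u].
      by apply/cnt_gt0; exists c => //=; rewrite xc rc yc u'c.
    by move: (lam _) => m; clear; lia.
  move/cnt_uniq => /(_ c d Bc Bd) /=; rewrite xc rc yc u'c xd rd yd u'd => /(_ isT isT) Ecd.
  have := dE _ r'x (partner_neq r); rewrite -Ecd r'c => /esym/eqP.
  have : simple x r (partner r) by move: Tr'; rewrite -Exr in_hexad (negPf r'x) (negPf (partner_neq r)).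
  by move/simple_lam3 => ->.
(* Case [t = partner u]. At most four blocks contain [x], [r] and [partner u], and four of them
   contain [s], so [c] does. But [s] is in the hexad of [x] and [y], where counts are 4 and not
   3. *)
have : s \in c.
  apply: (@cnt_eq_mem _ B [:: x; r; partner u]) => //=; last by rewrite xc rc u'c.
  apply: leq_trans (_ : 4 <= _).
    by apply: lam3_le4; rewrite uniq3 (nonpartner_neq nxr) !(neqM _ _ _ _ nTt).
  by rewrite -ts4 lam_rot4.
rewrite cE // 1?eq_sym // => /eqP.
have : simple x y s by move: Ss; rewrite -Exy in_hexad (negPf sx) eq_sym (negPf ys).
by move/simple_lam3 => ->.
Qed.

End Cover12.

Lemma covering_12_6_4 (X : finType) (B : {set {set X}}) : #|X| = 12 ->
  (forall b, b \in B -> #|b| = 6) ->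
  (forall S : {set X}, #|S| = 4 -> exists2 b, b \in B & S \subset b) -> 41 <= #|B|.
Proof.
move=> cX b6 c4; rewrite ltnNge; apply/negP; exact: no_covering40 cX b6 c4.
Qed.

(** * The Schonheim inequality *)

Section Derived.
Variables (X : finType) (B : {set {set X}}) (j : nat).
Hypothesis cardX : #|X| = 12 + j.
Hypothesis blockB : forall b, b \in B -> #|b| = 6 + j.
Hypothesis coverB : forall S : {set X}, #|S| = 4 + j -> exists2 b, b \in B & S \subset b.

(** The blocks containing [s], with its points removed, form a (12,6,4) covering of the twelve
    remaining points. Passing to images cannot increase the number of blocks. *)
Lemma derived_ge41 s : uniq s -> size s = j -> 41 <= cnt B s.
Proof.
move=> us sj; pose Y := {x : X | x \notin s}; pose A := [set x in s].
have cA : #|A| = j by rewrite cardsE (card_uniqP us).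
have imE (b : {set X}) : val @: ((val : Y -> X) @^-1: b) = b :\: A.
  apply/setP => x; apply/imsetP/setDP => [[y]|[bx]]; rewrite !inE.
    by move=> by_ ->; rewrite by_ (valP y).
  by move=> nx; exists (Sub x nx); rewrite ?inE SubK.
pose restr (b : {set X}) := (val : Y -> X) @^-1: b.
rewrite /cnt; set Bs := [set b in B | _]; apply: leq_trans (leq_imset_card restr (mem Bs)).
apply: covering_12_6_4.
- have := cardX; rewrite card_sig -[#|X|](cardC [in s]) (card_uniqP us) sj addnC => /addIn <-.
  by apply: eq_card => x; rewrite !inE.
- move=> c /imsetP[b + ->]; rewrite inE => /andP[Bb sb].
  rewrite -(card_imset _ val_inj) imE cardsD blockB // (setIidPr _) ?cA ?addnK //.
  by apply/subsetP => x; rewrite inE; apply: (allP sb).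
move=> S cS; have [|b Bb /subsetP sub] := @coverB (A :|: val @: S).
  rewrite cardsU cA card_imset ?cS; last exact: val_inj.
  have -> : A :&: val @: S = set0; last by rewrite cards0 subn0 addnC.
  apply/setP => x; rewrite !inE; apply/negP => /andP[xs /imsetP[y _ Ex]].
  by have := valP y; rewrite -Ex xs.
exists (val @^-1: b).
  apply: imset_f; rewrite inE Bb; apply/allP => x xs; apply: sub.
  by rewrite inE inE xs.
by apply/subsetP => y Sy; rewrite inE; apply: sub; rewrite inE imset_f ?orbT.
Qed.

(** Adding [6 + e] before dividing by [7 + e] rounds the quotient up. The values from [d = 0] to
    [d = 4] are 41, 77, 135, 225, 360. *)
Fixpoint schonheim_bound d :=
  if d is e.+1 then ((13 + e) * schonheim_bound e + (6 + e)) %/ (7 + e) else 41.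

(** Induction on the number [d] of points that can still be added to [s]; the step counts in two
    ways the points outside [s] on blocks through [s]. *)
Lemma schonheim_lower d s : uniq s -> d + size s = j -> schonheim_bound d <= cnt B s.
Proof.
elim: d s => [|d IHd] s us ds; first exact: derived_ge41.
pose Z := ~: [set z in s].
have cZ : #|Z| = 13 + d.
  by rewrite cardsCs setCK cardX cardsE (card_uniqP us) -ds; move: (size s) => n; clear; lia.
have sumZ : \sum_(z in Z) cnt B (z :: s) = (7 + d) * cnt B s.
  apply: cnt_sum_const => b Bb sb; rewrite -setDE cardsD blockB // (setIidPr _).
    by rewrite cardsE (card_uniqP us) -ds; move: (size s) => n; clear; lia.
  by apply/subsetP => x; rewrite inE; apply: (allP sb).
have : \sum_(z in Z) schonheim_bound d <= \sum_(z in Z) cnt B (z :: s).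
  apply: leq_sum => z; rewrite !inE => zs; apply: IHd; first by rewrite /= zs.
  by rewrite /= -ds addSnnS.
rewrite sumZ sum_nat_const cZ /= => le.
rewrite -ltnS ltn_divLR //; move: (schonheim_bound d) (cnt B s) le; clear; lia.
Qed.

End Derived.

Lemma covering_number_ge j : schonheim_bound j <= covering_number (12 + j) (6 + j) (4 + j).
Proof.
have [|B /andP[/forall_inP bB /forall_inP cB] <-] := @covering_number_attained (12 + j) (6 + j) (4 + j).
  by rewrite !leq_add2r.
have <- : cnt B [::] = #|B| by apply: eq_card => b; rewrite inE andbT.
apply: (@schonheim_lower _ _ j) => //.
- by rewrite card_ord.
- by move=> b /bB/eqP.
- by move=> S /eqP/cB/exists_inP.
exact: addn0.
Qed.

Theorem corollary17 :
  [/\ 77 <= covering_number 13 7 5,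
      135 <= covering_number 14 8 6,
      225 <= covering_number 15 9 7 &
      360 <= covering_number 16 10 8].
Proof.
split.
- exact: (covering_number_ge 1).
- exact: (covering_number_ge 2).
- exact: (covering_number_ge 3).
- exact: (covering_number_ge 4).
Qed.
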